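(* Let $(M,g,U,\mathcal{B},\mathcal{E})$ and $(M',g',U',\mathcal{B}',\mathcal{E}')$ be two 2-dimensional mechanical billiard systems, where $\mathcal{E}$ and $\mathcal{E}'$ consist of regular values of the respective energies. Let $\phi:M\to M'$ be a conformal $k$-to-$1$ smooth regular mapping for some $k\in\mathbb{N}_{+}$ and assume that $\phi(\mathcal{B})\subset\mathcal{B}'$. Suppose also that its cotangent lift $\Phi:T^*M\to T^*M'$ sends each energy hypersurface with energy $e\in\mathcal{E}$ to an energy hypersurface with energy $e'\in\mathcal{E}'$. Under these assumptions, if $(M',g',U',\mathcal{B}',\mathcal{E}')$ is integrable, then $(M,g,U,\mathcal{B},\mathcal{E})$ is also integrable. Additionally, if $(M,g,U,\mathcal{B},\mathcal{E})$ is integrable, and $\psi(\mathcal{B}')\subset\mathcal{B}$ for a smooth inverse branch $\psi:M'\to M$ of $\phi:M\to M'$, and the cotangent lift $\Psi:T^*M'\to T^*M$ of $\psi$ sends each energy hypersurface with energy $e'\in\mathcal{E}'$ to an energy hypersurface with energy $e\in\mathcal{E}$, then $(M',g',U',\mathcal{B}',\mathcal{E}')$ is also integrable.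
   Context: A 2-dimensional mechanical billiard system $(M,g,U,\mathcal{B},\mathcal{E})$ consists of a 2-dimensional Riemannian manifold $(M,g)$, a smooth force function $U:M\to\mathbb{R}$ (the potential is $-U$), a $C^1$-smooth curve $\mathcal{B}\subset M$ (the reflection wall), and a set $\mathcal{E}\subset\mathbb{R}$ of energies. The motion inside $M$ is given by Newton's equation $\nabla_{\dot q}\dot q=\nabla_g U(q)$ ($\nabla$ the Levi-Civita connection of $g$), equivalently by the Hamiltonian flow on $T^*M$ (canonical symplectic form) of the energy $E=T-U$, with $T$ the kinetic energy of $g$; motions are assumed to have energy in $\mathcal{E}$ and are reflected elastically at $\mathcal{B}$ (the tangential component of the velocity is kept and the normal component changes sign). The system is called integrable if there exists a $C^\infty$ function $G:T^*M\to\mathbb{R}$, independent of the energy $E$, which is preserved by the motions (with energies in $\mathcal{E}$) and by the reflections at $\mathcal{B}$. It is not required that the billiard mapping be always well-defined. A regular mapping is a smooth map whose derivative is everywhere an isomorphism. The cotangent lift $\Phi:T^*M\to T^*M'$ of a ($k$-to-$1$) regular mapping $\phi:M\to M'$ is $\Phi(x,\xi)=(\phi(x),(d\phi_x^* )^{-1}\xi)$, where $d\phi_x^*:T^*_{\phi(x)}M'\to T^*_xM$ is the adjoint of $d\phi_x$. An inverse branch of $\phi$ is a map $\psi:M'\to M$ with $\phi\circ\psi=\mathrm{id}_{M'}$. *)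

(* Defs.v *)
From HB Require Import structures.
From mathcomp Require Import all_boot all_order all_algebra.
From mathcomp Require Import all_classical all_reals all_analysis.

Set Implicit Arguments.
Unset Strict Implicit.
Unset Printing Implicit Defensive.

Import Order.TTheory GRing.Theory Num.Theory.
Import numFieldNormedType.Exports.

Local Open Scope classical_set_scope.
Local Open Scope ring_scope.

(* For an open [D] of a finite-dimensional [V], this is the class C^k on [D];
   values of [f] outside [D] are irrelevant. *)
Fixpoint Ck_on (R : realType) (V W : normedModType R) (k : nat) (D : set V)
    (f : V -> W) : Prop :=
  if k is k'.+1 then
    (forall x, D x -> differentiable f x) /\
    (forall v, Ck_on k' D (fun x => 'D_v f x))
  else forall x, D x -> {for x, continuous f}.

Definition smooth_on (R : realType) (V W : normedModType R) (D : set V)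
    (f : V -> W) : Prop := forall k, Ck_on k D f.

(* A homeomorphism from the open set [dom] onto the open set [img].  The two
   underlying functions are total, with junk values outside [dom] and [img]. *)
Record chart (R : realType) (M : topologicalType) := Chart {
  dom : set M;
  img : set 'rV[R]_2;
  coord : M -> 'rV[R]_2;
  param : 'rV[R]_2 -> M;
  dom_open : open dom;
  img_open : open img;
  coord_img : forall x, dom x -> img (coord x);
  param_dom : forall q, img q -> dom (param q);
  coordK : forall x, dom x -> param (coord x) = x;
  paramK : forall q, img q -> coord (param q) = q;
  coord_continuous : forall x, dom x -> {for x, continuous coord};
  param_continuous : forall q, img q -> {for q, continuous param} }.

(* [chart_at x] is a chosen chart around [x]; it only serves to represent
   tangent and cotangent vectors at [x] by row vectors. *)
Record surface (R : realType) := Surface {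
  pt :> topologicalType;
  pt_hausdorff : hausdorff_space pt;
  pt_second_countable : @second_countable pt;
  atlas : set (chart R pt);
  chart_at : pt -> chart R pt;
  chart_at_atlas : forall x, atlas (chart_at x);
  chart_at_dom : forall x, dom (chart_at x) x;
  atlas_smooth : forall c c', atlas c -> atlas c' ->
    smooth_on (img c `&` param c @^-1` dom c') (coord c' \o param c) }.
Arguments atlas {R} s _.

Definition smooth_function (R : realType) (M : surface R) (f : M -> R) : Prop :=
  forall c, atlas M c -> smooth_on (img c) (f \o param c).

Definition smooth_map (R : realType) (M M' : surface R) (phi : M -> M') : Prop :=
  continuous phi /\
  forall c c', atlas M c -> atlas M' c' ->
    smooth_on (img c `&` param c @^-1` (phi @^-1` dom c'))
      (coord c' \o phi \o param c).

(* A row vector [v] at [x] stands for the tangent vector with components [v] in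
   [chart_at x]; a row vector [xi] at [x] stands for the covector with
   components [xi] in [chart_at x], the pairing being xi *m v^T.  Jacobians act
   on row vectors from the right. *)

(* Jacobian at [x] of the change of coordinates from [c] to [chart_at x]. *)
Definition jac_from_chart (R : realType) (M : surface R) (c : chart R M)
    (x : M) : 'M[R]_2 :=
  jacobian (coord (chart_at x) \o param c) (coord c x).

(* Jacobian at [x] of the change of coordinates from [chart_at x] to [c]. *)
Definition jac_to_chart (R : realType) (M : surface R) (c : chart R M)
    (x : M) : 'M[R]_2 :=
  jacobian (coord c \o param (chart_at x)) (coord (chart_at x) x).

(* The differential of [phi] at [x] is v |-> v *m tangent_map phi x. *)
Definition tangent_map (R : realType) (M M' : surface R) (phi : M -> M')
    (x : M) : 'M[R]_2 :=
  jacobian (coord (chart_at (phi x)) \o phi \o param (chart_at x))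
    (coord (chart_at x) x).

Definition regular_map (R : realType) (M M' : surface R) (phi : M -> M') : Prop :=
  smooth_map phi /\ forall x, tangent_map phi x \in unitmx.

(* The underlying set of T^*M.  Its manifold structure is not the product one:
   it is given by the canonical coordinates (q, p) below. *)
Definition cotangent (R : realType) (M : surface R) : Type := (M * 'rV[R]_2)%type.

(* Canonical coordinates (q, p) on T^*M induced by the chart [c], defined over
   [dom c] and with values in [img c `*` setT], and the inverse map. *)
Definition cocoord (R : realType) (M : surface R) (c : chart R M)
    (z : cotangent M) : 'rV[R]_2 * 'rV[R]_2 :=
  (coord c z.1, z.2 *m (jac_from_chart c z.1)^T).

Definition coparam (R : realType) (M : surface R) (c : chart R M)
    (z : 'rV[R]_2 * 'rV[R]_2) : cotangent M :=
  (param c z.1, z.2 *m (jac_to_chart c (param c z.1))^T).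

Definition smooth_cotangent_function (R : realType) (M : surface R)
    (G : cotangent M -> R) : Prop :=
  forall c, atlas M c ->
    smooth_on (img c `*` [set: 'rV[R]_2]) (G \o coparam c).

(* [phi x] together with the image of the covector under the inverse of the
   adjoint of the differential of [phi] at x. *)
Definition cotangent_lift (R : realType) (M M' : surface R) (phi : M -> M')
    (z : cotangent M) : cotangent M' :=
  (phi z.1, z.2 *m invmx (tangent_map phi z.1)^T).

Definition C1_arc (R : realType) (M : surface R) (beta : R -> M) (a b : R) : Prop :=
  forall t, a < t < b ->
    {for t, continuous beta} /\
    forall c, atlas M c -> dom c (beta t) ->
      derivable (coord c \o beta) t 1 /\
      {for t, continuous (derive1 (coord c \o beta))}.

Definition velocity (R : realType) (M : surface R) (beta : R -> M) (t : R) :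
    'rV[R]_2 :=
  derive1 (coord (chart_at (beta t)) \o beta) t.

(* One-dimensional embedded C^1 submanifold; end points (the case of the
   half-open parameter interval) are allowed. *)
Definition C1_curve (R : realType) (M : surface R) (B : set M) : Prop :=
  forall x, B x ->
  exists (W : set M) (eps : R) (beta : R -> M) (J : set R) (sigma : M -> R),
    [/\ open W, W x, 0 < eps,
        J = [set` `]- eps, eps[] \/ J = [set` `[0, eps[] &
        [/\ C1_arc beta (- eps) eps,
            forall t, - eps < t < eps -> velocity beta t != 0,
            beta 0 = x,
            beta @` J = B `&` W &
            (forall t, J t -> sigma (beta t) = t) /\
            {within B `&` W, continuous sigma}]].

(* One-sided inclusion in [B], so that end points of [B] have a tangent line
   too; at other points of a C^1 curve this gives the usual tangent line. *)
Definition tangent_to (R : realType) (M : surface R) (B : set M) (x : M)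
    (tau : 'rV[R]_2) : Prop :=
  exists (beta : R -> M) (eps : R),
    [/\ 0 < eps, C1_arc beta (- eps) eps, beta 0 = x,
        forall t, 0 <= t < eps -> B (beta t) & velocity beta 0 = tau].

Definition form2 (R : realType) (A : 'M[R]_2) (u v : 'rV[R]_2) : R :=
  (u *m A *m v^T) 0 0.

(* [gram x] is the Gram matrix of the metric in the basis of the tangent space
   at [x] given by [chart_at x]; [metric_smooth] says that its Gram matrix in
   the coordinates of any chart is smooth. *)
Record riemannian_surface (R : realType) := RiemannianSurface {
  surf :> surface R;
  gram : surf -> 'M[R]_2;
  metric_sym : forall x, (gram x)^T = gram x;
  metric_pos : forall x u, u != 0 -> 0 < form2 (gram x) u u;
  metric_smooth : forall c, atlas surf c ->
    smooth_on (img c) (fun q =>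
      jac_from_chart c (param c q) *m gram (param c q)
        *m (jac_from_chart c (param c q))^T) }.

Definition metric (R : realType) (M : riemannian_surface R) (x : M)
    (u v : 'rV[R]_2) : R := form2 (gram x) u v.

Definition conformal (R : realType) (M M' : riemannian_surface R)
    (phi : M -> M') : Prop :=
  forall x, exists2 lambda : R, 0 < lambda &
    forall u v, metric (phi x) (u *m tangent_map phi x) (v *m tangent_map phi x)
                = lambda * metric x u v.

(* The covector g(v, .). *)
Definition momentum (R : realType) (M : riemannian_surface R) (x : M)
    (v : 'rV[R]_2) : cotangent M := (x, v *m gram x).

Definition tangential (R : realType) (M : riemannian_surface R) (x : M)
    (tau v : 'rV[R]_2) : 'rV[R]_2 :=
  (metric x v tau / metric x tau tau) *: tau.

Definition reflect_velocity (R : realType) (M : riemannian_surface R) (x : M)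
    (tau v : 'rV[R]_2) : 'rV[R]_2 :=
  tangential x tau v - (v - tangential x tau v).

(* Every point of the image has exactly [k] preimages; for [k = 1] this is
   injectivity.  Surjectivity is not required. *)
Definition k_to_1 (T T' : Type) (k : nat) (phi : T -> T') : Prop :=
  forall x, (phi @^-1` [set phi x] #= `I_k)%card.

Record billiard (R : realType) := Billiard {
  space :> riemannian_surface R;
  force : space -> R;
  force_smooth : smooth_function force;
  wall : set space;
  wall_C1 : C1_curve wall;
  energies : set R }.
Arguments wall {R} b _.
Arguments energies {R} b _.

(* E = T - U, where T(x, xi) is half the squared norm of [xi] for the dual
   metric. *)
Definition energy (R : realType) (S : billiard R) (z : cotangent S) : R :=
  2^-1 * form2 (invmx (gram z.1)) z.2 z.2 - force z.1.
Arguments energy {R} S z.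

Definition energy_level (R : realType) (S : billiard R) (e : R) :
    set (cotangent S) := [set z | energy S z = e].
Arguments energy_level {R} S e _.

Definition regular_energies (R : realType) (S : billiard R) : Prop :=
  forall e, energies S e -> forall c, atlas S c ->
  forall z : 'rV[R]_2 * 'rV[R]_2, img c z.1 -> energy_level S e (coparam c z) ->
  exists w : 'rV[R]_2 * 'rV[R]_2, 'd (energy S \o coparam c) z w != 0.

(* (dH/dp, - dH/dq), the Hamiltonian vector field of [H] in canonical
   coordinates (q, p). *)
Definition hamiltonian_field (R : realType) (H : 'rV[R]_2 * 'rV[R]_2 -> R)
    (z : 'rV[R]_2 * 'rV[R]_2) : 'rV[R]_2 * 'rV[R]_2 :=
  (\row_i 'd H z (0, delta_mx 0 i), - \row_i 'd H z (delta_mx 0 i, 0)).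

(* Integral curves on ]a, b[ of the Hamiltonian flow of E = T - U. *)
Definition motion (R : realType) (S : billiard R) (gamma : R -> cotangent S)
    (a b : R) : Prop :=
  forall t, a < t < b ->
    {for t, continuous (fun s => (gamma s).1)} /\
    forall c, atlas S c -> dom c (gamma t).1 ->
      is_derive t 1 (cocoord c \o gamma)
        (hamiltonian_field (energy S \o coparam c) (cocoord c (gamma t))).

Definition preserved_by_motions (R : realType) (S : billiard R)
    (G : cotangent S -> R) : Prop :=
  forall (gamma : R -> cotangent S) (a b e : R),
    motion gamma a b -> energies S e ->
    (forall t, a < t < b -> energy_level S e (gamma t)) ->
    forall s t, a < s < b -> a < t < b -> G (gamma s) = G (gamma t).

Definition preserved_by_reflections (R : realType) (S : billiard R)
    (G : cotangent S -> R) : Prop :=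
  forall (x : S) (tau v : 'rV[R]_2),
    wall S x -> tangent_to (wall S) x tau -> tau != 0 ->
    energies S (energy S (momentum x v)) ->
    G (momentum x (reflect_velocity x tau v)) = G (momentum x v).

Definition independent_at (R : realType) (V : normedModType R) (f h : V -> R)
    (z : V) : Prop :=
  forall a b : R, (forall w : V, a * 'd f z w + b * 'd h z w = 0) ->
    a = 0 /\ b = 0.

(* On each energy hypersurface with energy in the given set, dE and dG are
   linearly independent on a dense subset.  Independence is asked on each of
   these hypersurfaces since G is a first integral only there: a G that is
   constant on the only admissible level must not count. *)
Definition independent_of_energy (R : realType) (S : billiard R)
    (G : cotangent S -> R) : Prop :=
  forall e, energies S e -> forall c, atlas S c ->
  let level := [set z : 'rV[R]_2 * 'rV[R]_2 |
                 img c z.1 /\ energy_level S e (coparam c z)] in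
  level `<=` closure (level `&`
    [set z | independent_at (energy S \o coparam c) (G \o coparam c) z]).

Definition integrable_billiard (R : realType) (S : billiard R) : Prop :=
  exists G : cotangent S -> R,
    [/\ smooth_cotangent_function G, independent_of_energy G,
        preserved_by_motions G & preserved_by_reflections G].

Definition sends_levels (R : realType) (S S' : billiard R)
    (F : cotangent S -> cotangent S') : Prop :=
  forall e, energies S e ->
  exists2 e', energies S' e' & F @` energy_level S e `<=` energy_level S' e'.
Arguments sends_levels {R} S S' F.

(* Main.v *)
From mathcomp Require Import all_boot all_order all_algebra.
From mathcomp Require Import all_classical all_reals all_analysis.
From mathcomp Require Import ring lra.
Require Import Defs.

Set Implicit Arguments.
Unset Strict Implicit.
Unset Printing Implicit Defensive.

Import Order.TTheory GRing.Theory Num.Theory.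
Import numFieldNormedType.Exports.

Local Open Scope classical_set_scope.
Local Open Scope ring_scope.

(* If G' is an integral of the second system, then G := G' o Phi is one of the
   first.  Write E = T - U.  Conformality gives T' o Phi = kappa T for a positive
   function kappa on M, and since Phi maps the level E = e into a level E' = e',
   comparing energies yields kappa (U + e) = U' o phi + e' wherever U + e >= 0,
   because there the level contains a covector over each point.  Hence
   E' o Phi - e' = kappa (E - e) over {U + e > 0}, and d(E' o Phi) = kappa dE
   along the whole level, by density and regularity of e.  As Phi is symplectic,
   it sends the Hamiltonian field of E on this level to the one of E' up to the
   factor kappa, so motions go to motions after a change of time; independence
   is pulled back because Phi is a local diffeomorphism preserving the levels;
   and a conformal map commutes with reflections.  The inverse branch psi is
   itself regular and conformal, so the second claim is the first one for psi. *)

(** * Calculus of C^k maps *)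

(** Where U + e < 0 no covector has energy e, so the hypothesis on levels says nothing there about U
    and U' o phi. The energy relation can therefore be differentiated only over the open region U +
    e > 0. On its boundary the momentum vanishes, and regularity of e is what places level points of
    the open region arbitrarily near. The factor kappa is obtained from conformality one point at a
    time, hence without any continuity. Its smoothness is recovered afterwards, by writing it as a
    quotient of kinetic energies at a fixed nonzero momentum. Pulling back density of the
    independent points requires that points of T^*M' near the image of z be images of points near z.
    An open-image property is enough for this; it comes from minimising a squared distance, without
    building a local inverse. That Phi is symplectic comes down, in charts, to the symmetry of the
    second derivatives of phi. *)

Lemma near_eq_is_diff (R : numFieldType) (V W : normedModType R) (f g df : V -> W)
    (x : V) : (\near x, f x = g x) -> is_diff x f df -> is_diff x g df.
Proof.
move=> fg [dfx <-].
have fgx : f x = g x by exact: nbhs_singleton fg.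
(* This is the expansion of [g] with the differential of [f]; uniqueness of the differential then
   yields [Ed]. *)
have E : continuous ('d f x) /\ g \o shift x = cst (g x) + 'd f x +o_ 0 id.
  split; first exact: diff_continuous.
  apply/eqaddoP => e e0.
  have := diff_locally dfx => /eqaddoP/(_ e e0); apply: filter_app.
  have : \forall y \near (0 : V), f (y + x) = g (y + x).
    by move: fg; rewrite (near_shift 0 x) subr0.
  apply: filterS => y /= Ey.
  by rewrite !fctE -Ey -fgx; exact.
have Ed : 'd g x = 'd f x :> (V -> W) by apply/diff_unique; case: E.
by apply: DiffDef => //; apply/diff_locallyP; rewrite Ed.
Qed.

Lemma near_eq_differentiable (R : numFieldType) (V W : normedModType R)
    (f g : V -> W) (x : V) :
  (\near x, f x = g x) -> differentiable f x -> differentiable g x.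
Proof. by move=> fg /differentiableP /(near_eq_is_diff fg) []. Qed.

Lemma open_nbhs_eq (T : topologicalType) (U : Type) (D : set T) (f g : T -> U) x :
  open D -> (forall y, D y -> f y = g y) -> D x -> \near x, f x = g x.
Proof.
move=> oD fg Dx; apply: filterS (open_nbhs_nbhs (conj oD Dx)) => y; exact: fg.
Qed.

Section Ck.
Context {R : realType}.
Implicit Types (V W : normedModType R) (k : nat).

Lemma Ck_on_sub V W k (D E : set V) (f : V -> W) :
  D `<=` E -> Ck_on k E f -> Ck_on k D f.
Proof.
elim: k f => [|k IH] f DE /=; first by move=> cf x /DE; exact: cf.
by move=> [df Cf]; split=> [x /DE|v]; [exact: df|exact: IH].
Qed.

(** Openness of [D] turns equality on [D] into equality near each of its points, which is what
    derivatives see. *)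
Lemma Ck_on_eq V W k (D : set V) (f g : V -> W) :
  open D -> (forall x, D x -> f x = g x) -> Ck_on k D f -> Ck_on k D g.
Proof.
move=> oD; elim: k f g => [|k IH] f g fg /=.
  move=> cf x Dx; have := cf x Dx.
  rewrite /prop_for /continuous_at (fg _ Dx); apply: cvg_trans.
  by apply: near_eq_cvg; exact: open_nbhs_eq fg Dx.
move=> [df Cf]; split=> [x Dx|v].
  by apply: near_eq_differentiable (df x Dx); exact: open_nbhs_eq fg Dx.
apply: IH (Cf v) => x Dx; apply: near_eq_derive; exact: open_nbhs_eq fg Dx.
Qed.

(** The sets [E] may be arbitrary: [Ck_on] asserts properties of the total function at each point of
    its set, so it can be checked point by point. This is what glues smoothness from different
    target charts. *)
Lemma Ck_on_local V W k (D : set V) (f : V -> W) :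
  (forall x, D x -> exists2 E : set V, E x & Ck_on k E f) -> Ck_on k D f.
Proof.
elim: k f => [|k IH] f H /=.
  by move=> x /H [E Ex]; exact.
split=> [x /H [E Ex []] dE _|v]; first exact: dE.
by apply: IH => x /H [E Ex [_ /(_ v)]]; exists E.
Qed.

Lemma Ck_onW V W k (D : set V) (f : V -> W) : Ck_on k.+1 D f -> Ck_on k D f.
Proof.
elim: k f => [|k IH] f [df Cf] /=.
  by move=> x Dx; exact/differentiable_continuous/df.
by split=> // v; exact: IH.
Qed.

Lemma Ck_on_cst V W k (D : set V) (a : W) : Ck_on k D (fun=> a).
Proof.
elim: k a => [|k IH] a /=; first by move=> x _; exact: cst_continuous.
split=> [x _|v]; first exact: differentiable_cst.
suff -> : (fun x : V => 'D_v (fun=> a) x) = fun=> 0 by exact: IH.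
by apply/funext => x; rewrite derive_cst.
Qed.

Lemma Ck_on_lin V W k (D : set V) (f : {linear V -> W}) :
  continuous f -> Ck_on k D f.
Proof.
move=> cf; case: k => [|k] /=; first by move=> x _; exact: cf.
split=> [x _|v]; first exact: linear_differentiable.
suff -> : (fun x : V => 'D_v f x) = fun=> f v by exact: Ck_on_cst.
by apply/funext => x; rewrite deriveE ?diff_lin//; exact: linear_differentiable.
Qed.

Lemma Ck_on_add V W k (D : set V) (f g : V -> W) : open D ->
  Ck_on k D f -> Ck_on k D g -> Ck_on k D (fun x => f x + g x).
Proof.
move=> oD; elim: k f g => [|k IH] f g /=.
  by move=> cf cg x Dx; apply: continuousD; [exact: cf|exact: cg].
move=> [df Cf] [dg Cg]; split=> [x Dx|v].
  by apply: differentiableD; [exact: df|exact: dg].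
apply: Ck_on_eq (IH _ _ (Cf v) (Cg v)) => // x Dx.
by rewrite -deriveD//; apply: diff_derivable; [exact: df|exact: dg].
Qed.

Lemma Ck_on_sum V W k (D : set V) (I : Type) (s : seq I) (f : I -> V -> W) :
  open D -> (forall i, Ck_on k D (f i)) ->
  Ck_on k D (fun x => \sum_(i <- s) f i x).
Proof.
move=> oD Cf; elim: s => [|i s IH].
  by under [X in Ck_on _ _ X]eq_fun do rewrite big_nil; exact: Ck_on_cst.
by under [X in Ck_on _ _ X]eq_fun do rewrite big_cons; exact: Ck_on_add.
Qed.

Lemma Ck_on_mul V k (D : set V) (f g : V -> R) : open D ->
  Ck_on k D f -> Ck_on k D g -> Ck_on k D (fun x => f x * g x).
Proof.
move=> oD; elim: k f g => [|k IH] f g /=.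
  by move=> cf cg x Dx; apply: continuousM; [exact: cf|exact: cg].
move=> Cf Cg; have [df Cf'] := Cf; have [dg Cg'] := Cg.
split=> [x Dx|v].
  by apply: differentiableM; [exact: df|exact: dg].
have H := Ck_on_add oD (IH _ _ (Ck_onW Cf) (Cg' v)) (IH _ _ (Ck_onW Cg) (Cf' v)).
apply: Ck_on_eq H => // x Dx.
by rewrite -deriveM//; apply: diff_derivable; [exact: df|exact: dg].
Qed.

Lemma Ck_on_inv V k (D : set V) (f : V -> R) : open D ->
  (forall x, D x -> f x != 0) ->
  Ck_on k D f -> Ck_on k D (fun x => (f x)^-1).
Proof.
move=> oD f0; elim: k => [|k IH].
  by move=> cf x Dx; apply: continuousV; [exact: f0|exact: cf].
move=> Cf; have [df Cf'] := Cf; split=> [x Dx|v].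
  apply: differentiable_comp; first exact: df.
  by apply: differentiable_Rinv; exact: f0.
have Ci := IH (Ck_onW Cf).
(* Negatives and differences are written with the factor -1, here and below, so that sums, products
   and constants are the only closure properties to combine. [IH] concerns the same [f] at lower
   order, which covers both factors of 1/f^2. *)
have Cm := Ck_on_mul oD (Ck_on_cst k D (-1 : R)) (Ck_on_mul oD (Ck_on_mul oD Ci Ci) (Cf' v)).
apply: Ck_on_eq Cm => // x Dx.
rewrite (deriveV (f0 _ Dx) (diff_derivable (df _ Dx))).
by rewrite mulN1r -scaleNr -exprVn expr2.
Qed.

Lemma Ck_on_postlin V W W' k (D : set V) (f : V -> W) (l : {linear W -> W'}) :
  open D -> continuous l -> Ck_on k D f -> Ck_on k D (fun x => l (f x)).
Proof.
move=> oD cl; elim: k f => [|k IH] f /=.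
  move=> cf x Dx; apply: continuous_comp; [exact: cf|exact: cl].
move=> [df Cf]; split=> [x Dx|v].
  by apply: differentiable_comp; [exact: df|exact: linear_differentiable].
apply: Ck_on_eq (IH _ (Cf v)) => // x Dx.
have dl : differentiable l (f x) by exact: linear_differentiable.
have dfx := df _ Dx.
rewrite (deriveE v (differentiable_comp dfx dl)) (diff_comp dfx dl)/=.
by rewrite (diff_lin _ cl) deriveE.
Qed.

Lemma Ck_on_prelin V W W' k (D : set W') (f : W' -> W) (l : {linear V -> W'}) :
  open (l @^-1` D) -> continuous l -> Ck_on k D f ->
  Ck_on k (l @^-1` D) (fun x => f (l x)).
Proof.
move=> oD cl; elim: k f => [|k IH] f /=.
  move=> cf x Dx; apply: continuous_comp; [exact: cl|exact: cf].
move=> [df Cf].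
have dl x : differentiable l x by exact: linear_differentiable.
split=> [x Dx|v].
  by apply: differentiable_comp; [exact: dl|exact: df].
apply: Ck_on_eq (IH _ (Cf (l v))) => // x Dx; have dfx := df _ Dx.
rewrite (deriveE v (differentiable_comp (dl x) dfx)) (diff_comp (dl x) dfx)/=.
by rewrite (diff_lin _ cl) deriveE.
Qed.

(** By the chain rule the derivative of [g \o f] is a derivative of [g] in a direction that depends
    on x, whereas [Ck_on] controls fixed directions only. Expanding that direction in a finite
    family [e], with coordinate functions [l], reduces to fixed directions and lets the induction
    run. *)
Lemma Ck_on_comp V W k (D : set V) (E : set W) (f : V -> W) (g : W -> R)
    (I : finType) (e : I -> W) (l : I -> W -> R) :
  (forall i j (h : V -> W), Ck_on j D h -> Ck_on j D (l i \o h)) ->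
  (forall w, w = \sum_i l i w *: e i) ->
  open D -> (forall x, D x -> E (f x)) ->
  Ck_on k D f -> Ck_on k E g -> Ck_on k D (g \o f).
Proof.
move=> cl le oD DE; elim: k g => [|k IH] g.
  move=> cf cg x Dx; apply: continuous_comp; [exact: cf|exact/cg/DE].
move=> Cf [dg Cg]; have [df Cf'] := Cf; split=> [x Dx|v].
  by apply: differentiable_comp; [exact: df|exact/dg/DE].
have H : Ck_on k D (fun x => \sum_i l i ('D_v f x) * 'D_(e i) g (f x)).
  apply: Ck_on_sum => // i; apply: Ck_on_mul => //.
    by apply: (cl i k (fun x => 'D_v f x)); exact: Cf'.
  by apply: (IH (fun y => 'D_(e i) g y)); [exact: Ck_onW|exact: Cg].
apply: Ck_on_eq H => // x Dx.
have dfx := df _ Dx; have dgx := dg _ (DE _ Dx).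
rewrite (deriveE v (differentiable_comp dfx dgx)) (diff_comp dfx dgx)/=.
rewrite [X in 'd g _ X]le linear_sum/=.
by apply: eq_bigr => i _; rewrite linearZ/= (deriveE _ dfx) (deriveE _ dgx).
Qed.

Lemma Ck_on_scalel V W k (D : set V) (f : V -> R) (w : W) :
  open D -> Ck_on k D f -> Ck_on k D (fun x => f x *: w).
Proof.
move=> oD; elim: k f => [|k IH] f /=.
  move=> cf x Dx; apply: (@continuous_comp _ _ _ f ( *:%R^~ w)); first exact: cf.
  exact: scalel_continuous.
move=> [df Cf]; split=> [x Dx|v]; first by apply: differentiableZl; exact: df.
apply: Ck_on_eq (IH _ (Cf v)) => // x Dx; have dfx := df _ Dx.
by rewrite !deriveE ?diffZl//; exact: differentiableZl.
Qed.

Lemma Ck_on_pair V W W' k (D : set V) (f : V -> W) (g : V -> W') : open D ->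
  Ck_on k D f -> Ck_on k D g -> Ck_on k D (fun x => (f x, g x)).
Proof.
move=> oD; elim: k f g => [|k IH] f g /=.
  by move=> cf cg x Dx; apply: cvg_pair; [exact: cf|exact: cg].
move=> [df Cf] [dg Cg]; split=> [x Dx|v].
  by apply: differentiable_pair; [exact: df|exact: dg].
apply: Ck_on_eq (IH _ _ (Cf v) (Cg v)) => // x Dx.
have dfx := df _ Dx; have dgx := dg _ Dx.
by rewrite !deriveE ?diff_pair//; exact: differentiable_pair.
Qed.

Lemma Ck_on_entry V m n k (D : set V) (f : V -> 'M[R]_(m, n)) i j :
  open D -> Ck_on k D f -> Ck_on k D (fun x => f x i j).
Proof.
move=> oD; elim: k f => [|k IH] f.
  move=> cf x Dx.
  apply: (@continuous_comp _ _ _ f (fun M : 'M[R]_(m, n) => M i j)); first exact: cf.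
  exact: matrix_normedtype.coord_continuous.
move=> [df Cf]; split=> [x Dx|v].
  apply: (@differentiable_comp _ _ _ _ f (fun M : 'M[R]_(m, n) => M i j)).
    exact: df.
  exact: differentiable_coord.
apply: Ck_on_eq (IH _ (Cf v)) => // x Dx.
by rewrite (derive_mx (diff_derivable (df _ Dx))) mxE.
Qed.

Lemma Ck_on_row V n k (D : set V) (f : V -> 'rV[R]_n) : open D ->
  (forall j, Ck_on k D (fun x => f x 0 j)) -> Ck_on k D f.
Proof.
move=> oD Cf.
have H : Ck_on k D (fun x => \sum_j f x 0 j *: (delta_mx 0 j : 'rV[R]_n)).
  by apply: Ck_on_sum => // j; exact: Ck_on_scalel.
by apply: Ck_on_eq H => // x _; rewrite -row_sum_delta.
Qed.

Lemma Ck_on_prod V k (D : set V) (I : Type) (s : seq I) (f : I -> V -> R) :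
  open D -> (forall i, Ck_on k D (f i)) ->
  Ck_on k D (fun x => \prod_(i <- s) f i x).
Proof.
move=> oD Cf; elim: s => [|i s IH].
  by under [X in Ck_on _ _ X]eq_fun do rewrite big_nil; exact: Ck_on_cst.
by under [X in Ck_on _ _ X]eq_fun do rewrite big_cons; exact: Ck_on_mul.
Qed.

Lemma Ck_on_det V n k (D : set V) (A : V -> 'M[R]_n) : open D ->
  (forall i j, Ck_on k D (fun x => A x i j)) -> Ck_on k D (fun x => \det (A x)).
Proof.
move=> oD CA; rewrite /determinant; apply: Ck_on_sum => // s.
by apply: Ck_on_mul => //; [exact: Ck_on_cst|exact: Ck_on_prod].
Qed.

(** The cofactor formula expresses each entry by determinants and a single inversion of a nonzero
    function. *)
Lemma Ck_on_invmx V n k (D : set V) (A : V -> 'M[R]_n) : open D ->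
  (forall x, D x -> A x \in unitmx) ->
  (forall i j, Ck_on k D (fun x => A x i j)) ->
  forall i j, Ck_on k D (fun x => invmx (A x) i j).
Proof.
move=> oD uA CA i j.
have H : Ck_on k D (fun x => (\det (A x))^-1 *
    ((-1) ^+ (j + i) * \det (row' j (col' i (A x))))).
  apply: Ck_on_mul => //.
    apply: Ck_on_inv => //; last exact: Ck_on_det.
    by move=> x /uA; rewrite unitmxE unitfE.
  apply: Ck_on_mul => //; first exact: Ck_on_cst.
  apply: Ck_on_det => // i' j'.
  by under [X in Ck_on _ _ X]eq_fun do rewrite !mxE; exact: CA.
by apply: Ck_on_eq H => // x Dx; rewrite /invmx uA// !mxE.
Qed.

End Ck.

(** * Jacobians acting on row vectors *)

Section Jacobian.
Context {R : numFieldType}.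

Lemma derive_comp (U V W : normedModType R) (f : U -> V) (g : V -> W) x v :
  differentiable f x -> differentiable g (f x) ->
  'D_v (g \o f) x = 'D_('D_v f x) g (f x).
Proof.
move=> df dg; rewrite (deriveE v (differentiable_comp df dg)) (diff_comp df dg)/=.
by rewrite (deriveE _ df) (deriveE _ dg).
Qed.

Lemma row_jacobian m n (f : 'rV[R]_m -> 'rV[R]_n) x i :
  differentiable f x -> row i (jacobian f x) = 'D_(delta_mx 0 i) f x.
Proof. by move=> df; rewrite rowE deriveEjacobian. Qed.

(** Jacobians act on row vectors from the right, so the factors stand in the order in which the maps
    are applied. *)
Lemma jacobian_comp m n p (f : 'rV[R]_m -> 'rV[R]_n) (g : 'rV[R]_n -> 'rV[R]_p) x :
  differentiable f x -> differentiable g (f x) ->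
  jacobian (g \o f) x = jacobian f x *m jacobian g (f x).
Proof.
move=> df dg; have dgf := differentiable_comp df dg.
apply/row_matrixP => i.
rewrite row_mul (row_jacobian i dgf) (row_jacobian i df) (derive_comp _ df dg).
by rewrite (deriveEjacobian _ dg).
Qed.

Lemma near_eq_jacobian m n (f g : 'rV[R]_m -> 'rV[R]_n) (x : 'rV[R]_m) :
  (\near x, f x = g x) -> differentiable f x -> jacobian g x = jacobian f x.
Proof.
move=> fg df; have dg := near_eq_differentiable fg df.
apply/row_matrixP => i.
have E1 := row_jacobian i dg.
have E2 := row_jacobian i df.
rewrite [LHS]E1.
rewrite E2.
have H := near_eq_derive (delta_mx 0 i) fg.
by rewrite H.
Qed.

Lemma jacobian_id n (x : 'rV[R]_n) : jacobian id x = 1%:M.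
Proof. by apply/row_matrixP => i; rewrite (row_jacobian i (f := id)) ?derive_id ?row1. Qed.

Lemma jacobian_entry m n (f : 'rV[R]_m -> 'rV[R]_n) x i j :
  differentiable f x -> jacobian f x i j = 'D_(delta_mx 0 i) f x 0 j.
Proof. by move=> df; rewrite -(row_jacobian i df) [RHS]mxE. Qed.

End Jacobian.

(** * Restriction to lines and mean value arguments *)

Section Lines.
Context {R : realType}.
Implicit Types V : normedModType R.

Lemma mulmxr_continuous m n (A : 'M[R]_(m, n)) :
  continuous (fun w : 'rV[R]_m => w *m A).
Proof.
suff H : Ck_on 0 setT (fun w : 'rV[R]_m => w *m A) by move=> w; exact: H.
apply: Ck_on_row => [|j]; first exact: openT.
have H : Ck_on 0 setT (fun w : 'rV[R]_m => \sum_i w 0 i * A i j).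
  apply: Ck_on_sum => [|i]; first exact: openT.
  apply: Ck_on_mul; [exact: openT| |exact: Ck_on_cst].
  by apply: (@Ck_on_entry _ _ _ _ _ _ id); [exact: openT|move=> x _; exact: cvg_id].
by apply: Ck_on_eq H => [|w _]; [exact: openT|rewrite mxE].
Qed.

Lemma is_derive_line V (W : normedModType R) (f : V -> W) x u s :
  differentiable f (s *: u + x) ->
  is_derive s 1 (fun t => f (t *: u + x)) ('D_u f (s *: u + x)).
Proof.
move=> df.
have dl : is_diff s (fun t : R => t *: u + x) ( *:%R^~ u).
  by apply: is_diff_eq; rewrite addr0.
have dc : differentiable (f \o (fun t : R => t *: u + x)) s.
  by apply: differentiable_comp.
apply: DeriveDef; first exact/diff_derivable.
by rewrite deriveE// diff_comp// diff_val/= scale1r deriveE.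
Qed.

Lemma MVT_line V (f : V -> R) x u t : 0 < t ->
  (forall s, 0 <= s <= t -> differentiable f (s *: u + x)) ->
  exists2 c, 0 < c < t & f (t *: u + x) - f x = t * 'D_u f (c *: u + x).
Proof.
move=> t0 df.
have [c|/=|c] := @MVT R (fun s => f (s *: u + x)) (fun s => 'D_u f (s *: u + x)) _ _ t0.
- rewrite in_itv/= => /andP[/ltW c0 /ltW ct].
  by apply/is_derive_line/df/andP.
- apply: derivable_within_continuous => s; rewrite in_itv/= => st.
  by have [] := is_derive_line (df _ st).
- rewrite in_itv/= => ct; rewrite scale0r add0r subr0 => ->.
  by exists c => //; rewrite mulrC.
Qed.

(** The mean value theorem is used twice: along [u], for the increment [g] of [f] under translation
    by [t *: v], and then along [v], for ['D_u f]. The left side of the equation is symmetric in [u]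
    and [v], the right side is not; comparing both orders gives Schwarz's theorem. *)
Lemma second_difference V (f : V -> R) x u v t : 0 < t ->
  (forall a b, 0 <= a <= t -> 0 <= b <= t ->
    differentiable f (a *: u + (b *: v + x)) /\
    differentiable ('D_u f) (a *: u + (b *: v + x))) ->
  exists c d, [/\ 0 < c < t, 0 < d < t &
    f (t *: u + (t *: v + x)) - f (t *: u + x) - f (t *: v + x) + f x =
    t * t * 'D_v ('D_u f) (c *: u + (d *: v + x))].
Proof.
move=> t0 df.
have t00 : 0 <= t <= t by rewrite lexx ltW.
have t0t : (0 : R) <= 0 <= t by rewrite lexx ltW.
pose g z := f (t *: v + z) - f z.
have dsh s : 0 <= s <= t -> differentiable f (t *: v + (s *: u + x)).
  by move=> st; have [] := df _ _ st t00; rewrite addrCA.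
have dsh0 s : 0 <= s <= t -> differentiable f (s *: u + x).
  by move=> st; have [] := df _ _ st t0t; rewrite scale0r add0r.
have dtr z : differentiable (fun z => t *: v + z) z by [].
have Dtr z : 'D_u (fun z => t *: v + z) z = u.
  by rewrite deriveD// derive_cst derive_id add0r.
have dgd s : 0 <= s <= t -> differentiable g (s *: u + x).
  move=> st; apply: differentiableB; last exact: dsh0.
  by apply: (@differentiable_comp _ _ _ _ _ f); [exact: dtr|exact: dsh].
have Dg s : 0 <= s <= t -> 'D_u g (s *: u + x) =
    'D_u f (t *: v + (s *: u + x)) - 'D_u f (s *: u + x).
  move=> st; have d1 := dsh _ st; have d2 := dsh0 _ st.
  have d3 := differentiable_comp (dtr (s *: u + x)) d1.
  rewrite (deriveB (diff_derivable d3) (diff_derivable d2)).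
  by rewrite (derive_comp u (dtr (s *: u + x)) d1) Dtr.
have [c c0t Ec] : exists2 c, 0 < c < t &
    g (t *: u + x) - g x = t * 'D_u g (c *: u + x).
  exact: MVT_line t0 dgd.
have c0t' : 0 <= c <= t by move/andP: c0t => [/ltW-> /ltW->].
have [d d0t Ed] : exists2 d, 0 < d < t & 'D_u f (t *: v + (c *: u + x)) -
    'D_u f (c *: u + x) = t * 'D_v ('D_u f) (d *: v + (c *: u + x)).
  apply: (MVT_line (f := 'D_u f) t0) => s st.
  by have [_] := df _ _ c0t' st; rewrite addrCA.
exists c, d; split; [exact: c0t|exact: d0t|].
rewrite [c *: u + _]addrCA -mulrA -Ed -(Dg _ c0t') -Ec /g [t *: u + (t *: v + x)]addrCA.
ring.
Qed.

End Lines.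

(** * Symmetry of mixed second derivatives *)

Section Schwarz.
Context {R : realType} {V : normedModType R}.

Let second_difference_approx (D : set V) (f : V -> R) x u v (e : R) :
  open D -> Ck_on 2 D f -> D x -> 0 < e ->
  exists2 d : R, 0 < d & forall t : R, 0 < t < d ->
    `|f (t *: u + (t *: v + x)) - f (t *: u + x) - f (t *: v + x) + f x
      - t * t * 'D_v ('D_u f) x| <= t * t * e.
Proof.
move=> oD Cf Dx e0.
have [df /(_ u) [ddf /(_ v) cddf]] := Cf.
have cx := cddf x Dx.
have [r /= r0 rD] : nbhs_ball x (fun y => D y /\
    `|'D_v ('D_u f) x - 'D_v ('D_u f) y| < e).
  apply/nbhs_ballP; apply: filterI; first exact: open_nbhs_nbhs.
  by move/cvgrPdist_lt : cx; exact.
have N0 : 0 < `|u| + `|v| + 1 by rewrite ltr_wpDl// addr_ge0.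
(* For t below this bound the whole parallelogram spanned by [t *: u] and [t *: v] at x lies in the
   ball of radius r; the summand 1 keeps the denominator positive when both vectors vanish. *)
exists (r / (`|u| + `|v| + 1)); first by rewrite divr_gt0.
move=> t /andP[t0]; rewrite ltr_pdivlMr// => tr.
have inb a b : 0 <= a <= t -> 0 <= b <= t -> ball x r (a *: u + (b *: v + x)).
  move=> /andP[a0 at_] /andP[b0 bt]; rewrite -ball_normE /= addrA opprD addrCA subrr addr0.
  rewrite normrN (le_lt_trans _ tr)// (le_trans (ler_normD _ _))//.
  rewrite !normrZ (ger0_norm a0) (ger0_norm b0) mulrDr mulrDr -[leLHS]addr0.
  by rewrite !lerD ?ler_wpM2r// mulr1 ltW.
have [a b a0t b0t|c [d [c0t d0t]]] := @second_difference R V f x u v t t0.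
  by have [Dab _] := rD _ (inb _ _ a0t b0t); split; [exact: df|exact: ddf].
move=> ->; have tt0 : 0 <= t * t by rewrite mulr_ge0// ltW.
rewrite -mulrBr normrM distrC (ger0_norm tt0) (ler_wpM2l tt0)//.
have w z : 0 < z < t -> 0 <= z <= t by move=> /andP[/ltW -> /ltW ->].
by have [_ /ltW] := rD _ (inb _ _ (w _ c0t) (w _ d0t)).
Qed.

(** For one small t, the same second difference is within t^2 e/2 of t^2 times either mixed
    derivative, so the two differ by at most e, for every e > 0. *)
Lemma derive_swap (D : set V) (f : V -> R) x u v :
  open D -> Ck_on 2 D f -> D x -> 'D_u ('D_v f) x = 'D_v ('D_u f) x.
Proof.
move=> oD Cf Dx; apply/eqP; rewrite -subr_eq0 -normr_le0; apply/ler_addgt0Pl => e e0.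
have e20 : 0 < e / 2 by rewrite divr_gt0.
have [d d0 Hd] := second_difference_approx u v oD Cf Dx e20.
have [d' d'0 Hd'] := second_difference_approx v u oD Cf Dx e20.
pose t := Num.min d d' / 2.
have m0 : 0 < Num.min d d' by rewrite lt_min d0.
have t0 : 0 < t by rewrite divr_gt0.
have tm : t < Num.min d d' by rewrite ltr_pdivrMr// ltr_pMr// ltr1n.
have /andP[td td'] : (t < d) && (t < d') by rewrite -lt_min.
have {Hd} := Hd t; rewrite t0 td => /(_ isT).
have {Hd'} := Hd' t; rewrite t0 td' => /(_ isT).
rewrite [t *: v + (t *: u + x)]addrCA.
set A := f _; set B := f (t *: v + x); set C := f (t *: u + x).
set P := 'D_u _ _; set Q := 'D_v _ _ => H1 H2.
have tt0 : 0 < t * t by rewrite mulr_gt0.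
rewrite addr0 -(ler_pM2l tt0).
have -> : t * t * `|P - Q| = `|(A - C - B + f x - t * t * Q) - (A - B - C + f x - t * t * P)|.
  by rewrite -[X in X * `|_|]gtr0_norm// -normrM; congr (`|_|); ring.
apply: le_trans (ler_normB _ _) _.
by rewrite [e]splitr mulrDr; exact: lerD H2 H1.
Qed.

End Schwarz.

(** * Open images under invertible Jacobians *)

Section LocalSurjectivity.
Context {R : realType}.

Lemma near_line (V : normedModType R) (P : set V) x v : nbhs x P ->
  \forall t \near (0 : R), P (t *: v + x).
Proof.
have d : differentiable (fun t : R => t *: v + x) 0 by [].
have := differentiable_continuous d; rewrite /prop_for /continuous_at scale0r add0r.
by move=> c Px; apply: c.
Qed.

Lemma derive_local_min (V : normedModType R) (f : V -> R) x v :
  (\forall y \near x, differentiable f y) ->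
  (\forall y \near x, f x <= f y) -> 'D_v f x = 0.
Proof.
move=> df mf.
have [d /= d0 dP] : nbhs_ball (0 : R)
    (fun t => differentiable f (t *: v + x) /\ f x <= f (t *: v + x)).
  by apply/nbhs_ballP; exact: filterI (near_line v df) (near_line v mf).
have dP' t : t \in `](- d), d[ ->
    differentiable f (t *: v + x) /\ f x <= f (t *: v + x).
  rewrite in_itv/= => td; apply: (dP t).
  by rewrite -ball_normE /= sub0r normrN ltr_norml.
have dfx : differentiable f (0 *: v + x) by have [] := dP' 0 _; rewrite ?in_itv/= ?oppr_lt0 ?d0.
have [|t /dP' [dt _]| |t /dP' [_]|_ E0] :=
    @derive1_at_min R (fun t => f (t *: v + x)) (- d) d 0.
- by rewrite ge0_cp// ltW.
- by have [] := is_derive_line dt.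
- by rewrite in_itv/= oppr_lt0 d0.
- by rewrite scale0r add0r.
- have [_] := is_derive_line dfx.
  by rewrite E0 scale0r add0r.
Qed.

Lemma norm_mx_entry m n (w : 'M[R]_(m, n)) i j : `|w i j| <= `|w|.
Proof.
rewrite [leRHS]/Num.Def.normr/= mx_normrE.
exact: (le_bigmax _ (fun ij => `|w ij.1 ij.2|) (i, j)).
Qed.

Lemma norm_row_max n (w : 'rV[R]_n) : w != 0 -> exists i, `|w| = `|w 0 i|.
Proof.
rewrite -normr_eq0 => w0; have [[i j] /= E] := mx_norm_neq0 w0.
by exists j; rewrite (ord1 i) in E; exact: E.
Qed.

Lemma jacobian_lower_bound n (f : 'rV[R]_n -> 'rV[R]_n) x :
  differentiable f x -> jacobian f x \in unitmx ->
  exists2 c : R, 0 < c & \forall y \near x, c * `|y - x| <= `|f y - f x|.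
Proof.
move=> df uJ; set J := jacobian f x.
have [C C0 HC] : exists2 C, 0 < C & forall w : 'rV[R]_n, `|w *m invmx J| <= C * `|w|.
  exact: (linear_lipschitz (f := mulmxr (invmx J)) (@mulmxr_continuous R _ _ (invmx J))).
(* The linear part moves h by at least |h| / C. Half of this is given up to absorb the remainder of
   the first-order expansion, the other half is the bound claimed. *)
have c0 : 0 < (C * 2)^-1 by rewrite invr_gt0 mulr_gt0.
exists (C * 2)^-1 => //.
have /eqaddoP /(_ _ c0) := diff_locally df.
rewrite [X in _ -> X](near_shift 0 x) subr0; apply: filterS => h /=.
rewrite !fctE /= -(deriveE h df) (deriveEjacobian h df) -/J addrK => H.
have h1 : `|h| <= C * `|h *m J| by rewrite -[X in `|X| <= _](mulmxK uJ).
have h2 : `|h *m J| <= `|f (h + x) - f x| + (C * 2)^-1 * `|h|.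
  have -> : h *m J = (f (h + x) - f x) - (f (h + x) - (f x + h *m J)).
    by rewrite opprB addrC addrA subrK addrC addKr.
  by rewrite (le_trans (ler_normB _ _))// lerD2l.
have h3 : C^-1 * `|h| <= `|h *m J| by rewrite ler_pdivrMl.
have -> : (C * 2)^-1 * `|h| = C^-1 * `|h| - (C * 2)^-1 * `|h|.
  by rewrite invfM; field; rewrite gt_eqF.
lra.
Qed.

Lemma sumr_sqr_eq0 n (w : 'rV[R]_n) : \sum_i w 0 i * w 0 i = 0 -> w = 0.
Proof.
move=> H; apply/rowP => i; rewrite mxE; apply/eqP.
have /allP/(_ i) : all (fun i => true ==> (w 0 i * w 0 i == 0)) (index_enum 'I_n).
  rewrite -psumr_eq0; first by rewrite H.
  by move=> j _; rewrite -expr2 sqr_ge0.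
by rewrite mem_index_enum => /(_ isT); rewrite mulf_eq0 orbb.
Qed.

(* A minimum of |f - y|^2 on a small closed ball around x is interior by the
   lower bound above, and there invertibility of the Jacobian forces f = y. *)
Lemma local_surjection n (f : 'rV[R]_n -> 'rV[R]_n) x (N : set 'rV[R]_n) :
  (\forall y \near x, differentiable f y /\ jacobian f y \in unitmx) ->
  nbhs x N -> nbhs (f x) (f @` N).
Proof.
move=> near_reg nN.
have [dfx uJ] := nbhs_singleton near_reg.
have [c c0 lbd] := jacobian_lower_bound dfx uJ.
have [r0 /= r00 Hr0] : nbhs_ball x (fun y =>
    ((differentiable f y /\ jacobian f y \in unitmx) /\ N y) /\
    c * `|y - x| <= `|f y - f x|).
  by apply/nbhs_ballP; do 2?apply: filterI.
pose r := r0 / 2.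
have r_gt0 : 0 < r by rewrite divr_gt0.
have rr0 : r < r0 by rewrite ltr_pdivrMr// ltr_pMr// ltr1n.
pose K := closed_ball x r.
have KE y : K y = (`|x - y| <= r) by rewrite /K closed_ballE.
have KP y : K y -> [/\ differentiable f y, jacobian f y \in unitmx, N y &
    c * `|y - x| <= `|f y - f x|].
  rewrite KE => Ky.
  have [|[[]]] := Hr0 y; last by [].
  by rewrite -ball_normE /= (le_lt_trans Ky).
have Kx : K x by rewrite KE subrr normr0 ltW.
have cK : compact K.
  apply: bounded_closed_compact; last exact: closed_ball_closed.
  exists (`|x| + r); split; first exact: num_real.
  move=> M ltM y; rewrite KE => Ky.
  have : `|y| <= `|y - x| + `|x| by rewrite -{1}(subrK x y) ler_normD.
  rewrite distrC => yx; apply: le_trans yx (le_trans _ (ltW ltM)).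
  by rewrite addrC lerD2l.
(* On the boundary of [K] the lower bound gives |f q - f x| >= c r = (n + 2) eta, hence |f q - y| >=
   (n + 1) eta in the maximum norm and a sum of squares of at least (n + 1)^2 eta^2. At the centre
   that sum is at most n eta^2, so the minimum is not on the boundary. *)
pose eta := c * r / n.+2%:R.
have n20 : 0 < n.+2%:R :> R by rewrite ltr0n.
have eta0 : 0 < eta by rewrite divr_gt0// mulr_gt0.
apply/nbhs_ballP; exists eta => //= y; rewrite -ball_normE /= => ye.
pose psi q := \sum_i (f q 0 i - y 0 i) * (f q 0 i - y 0 i).
have dentry q i : differentiable f q -> differentiable (fun q => f q 0 i - y 0 i) q.
  move=> dq; apply: differentiableB => //.
  apply: (@differentiable_comp _ _ _ _ f (fun M : 'rV[R]_n => M 0 i)) => //.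
  exact: differentiable_coord.
have psiE : psi = \sum_i ((fun q => f q 0 i - y 0 i) * (fun q => f q 0 i - y 0 i)).
  by apply/funext => z; rewrite fct_sumE.
have dpsi q : differentiable f q -> differentiable psi q.
  by move=> dq; rewrite psiE; apply: differentiable_sum => i; apply: differentiableM; exact: dentry.
have cpsi : {within K, continuous psi}.
  apply: continuous_in_subspaceT => q; rewrite inE => /KP[dq _ _ _].
  exact/differentiable_continuous/dpsi.
have [q] := EVT_min_rV (ex_intro _ x Kx) cK cpsi.
rewrite inE => Kq qmin.
have [dq uq Nq lq] := KP _ Kq.
have small : `|x - q| < r.
  have qr' : `|x - q| <= r by rewrite -KE.
  rewrite lt_neqAle qr' andbT; apply/eqP => qr.
  have qx : psi q <= psi x by apply: qmin; rewrite inE.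
  have psix : psi x <= n%:R * (eta * eta).
    have -> : n%:R * (eta * eta) = \sum_(i < n) eta * eta.
      by rewrite sumr_const card_ord mulr_natl.
    apply: ler_sum => i _; rewrite -[leLHS]ger0_norm -?expr2 ?sqr_ge0//.
    rewrite normrX expr2 ler_pM// (le_trans _ (ltW ye))//.
      by have := norm_mx_entry (f x - y) 0 i; rewrite !mxE.
    by have := norm_mx_entry (f x - y) 0 i; rewrite !mxE.
  have cre : c * r = eta * n%:R + eta * 2.
    by rewrite -mulrDr -natrD addn2 /eta divfK// gt_eqF.
  have far : eta * n%:R + eta <= `|f q - y|.
    have h : `|f q - f x| <= `|f q - y| + `|f x - y|.
      by rewrite -[f q - f x](subrKA y) (le_trans (ler_normD _ _))// [`|y - _|]distrC.
    move: lq; rewrite distrC qr cre; lra.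
  have n_ge0 : 0 <= n%:R :> R by [].
  have far0 : 0 < `|f q - y| by apply: lt_le_trans far; nra.
  have [|i Ei] := @norm_row_max _ (f q - y); first by rewrite -normr_gt0.
  have psiq : `|f q - y| * `|f q - y| <= psi q.
    rewrite Ei -normrM -expr2 ger0_norm ?sqr_ge0// expr2 /psi (bigD1 i)//= !mxE.
    by rewrite lerDl sumr_ge0// => j _; rewrite -expr2 sqr_ge0.
  have en0 : 0 <= eta * n%:R + eta by rewrite addr_ge0 ?mulr_ge0// ltW.
  have FF := ler_pM en0 en0 far far.
  have ee0 : 0 < eta * eta * (n%:R * n%:R + n%:R + 1).
    by rewrite mulr_gt0 ?mulr_gt0// ltr_wpDl// addr_ge0 ?mulr_ge0.
  have : (eta * n%:R + eta) * (eta * n%:R + eta) <= n%:R * (eta * eta).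
    exact: le_trans FF (le_trans psiq (le_trans qx psix)).
  lra.
have nq : \forall z \near q, K z.
  apply: filterS (@subset_closed_ball _ _ x r) _.
  by apply: open_nbhs_nbhs; split; [exact: ball_open|rewrite -ball_normE].
exists q => //; apply/eqP; rewrite -subr_eq0; apply/eqP/sumr_sqr_eq0.
(* In this direction the derivative of [f] at q is f q - y itself, so the derivative of [psi] is
   twice the sum of the squares of the entries of f q - y. *)
pose v := (f q - y) *m invmx (jacobian f q).
have D0 : 'D_v psi q = 0.
  apply: derive_local_min.
    by apply: filterS nq => z /KP[dz _ _ _]; exact: dpsi.
  by apply: filterS nq => z Kz; apply: qmin; rewrite inE.
have Dfq : 'D_v f q = f q - y by rewrite (deriveEjacobian v dq) mulmxKV.
have De i : 'D_v (fun q => f q 0 i - y 0 i) q = (f q - y) 0 i.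
  have dqi : differentiable (fun q => f q 0 i) q.
    apply: (@differentiable_comp _ _ _ _ f (fun M : 'rV[R]_n => M 0 i)) => //.
    exact: differentiable_coord.
  rewrite (deriveB (diff_derivable dqi) (derivable_cst _ _ _)) derive_cst subr0.
  by rewrite -Dfq (derive_mx (diff_derivable dq)) mxE.
move: D0; rewrite psiE derive_sum; last first.
  by move=> i; apply/diff_derivable/differentiableM; exact: dentry.
under eq_bigr => i _.
  rewrite (deriveM (diff_derivable (dentry _ i dq)) (diff_derivable (dentry _ i dq))).
  rewrite De -mulr2n [X in X *: _](_ : _ = (f q - y) 0 i); last by rewrite !mxE.
  over.
rewrite sumrMnl => /eqP; rewrite mulrn_eq0 => /orP[//|/eqP]; exact.
Qed.

End LocalSurjectivity.

(** * Change of time *)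

Section TimeChange.
Context {R : realType}.
Local Notation mu := lebesgue_measure.

(** The interval shrinks because continuity on an open interval does not give integrability up to
    its ends; on the segment [a', b'] it does. *)
Lemma antiderivative_exists (f : R -> R) a b :
  (forall u, a < u < b -> {for u, continuous f}) ->
  forall a' b', a < a' -> b' < b ->
  exists F : R -> R, forall u, a' < u < b' -> is_derive u 1 F (f u).
Proof.
move=> cf a' b' aa' bb'.
exists (fun x => (\int[mu]_(t in [set` `[a', x]]) f t)%R) => u /andP[au ub].
have fi : mu.-integrable `[a', b'] (EFin \o f).
  apply: continuous_compact_integrable; first exact: segment_compact.
  apply: continuous_in_subspaceT => z; rewrite inE /= in_itv/= => /andP[az zb].
  by apply: cf; rewrite (lt_le_trans aa')// (le_lt_trans zb).
have cu : {for u, continuous f}.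
  by apply: cf; rewrite (lt_trans aa')// (lt_trans ub).
have [dF EF] := continuous_FTC1_closed ub fi au cu.
by apply: DeriveDef; [exact: dF|rewrite -derive1E].
Qed.

(* tau is the inverse of an antiderivative of 1/k. *)
Lemma time_change (k : R -> R) a b s t :
  (forall u, a < u < b -> 0 < k u /\ {for u, continuous k}) ->
  a < s < b -> a < t < b ->
  exists (tau : R -> R) (c d : R),
    (forall u, c < u < d -> a < tau u < b /\ is_derive u 1 tau (k (tau u))) /\
    exists u1 u2, [/\ c < u1 < d, c < u2 < d, tau u1 = s & tau u2 = t].
Proof.
move=> Hk /andP[as_ sb] /andP[at_ tb].
pose m := Num.min s t; pose M := Num.max s t.
have am : a < m by rewrite lt_min as_.
have Mb : M < b by rewrite gt_max sb.
(* The interval is shrunk twice with s and t kept inside: the antiderivative of 1/k lives on ]a1,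
   b1[, and on the segment [a2, b2] within it is differentiable up to the end points. *)
pose a1 := (a + m) / 2; pose b1 := (M + b) / 2.
pose a2 := (a1 + m) / 2; pose b2 := (M + b1) / 2.
have [aa1 a1m] : a < a1 /\ a1 < m by rewrite /a1; split; lra.
have [Mb1 b1b] : M < b1 /\ b1 < b by rewrite /b1; split; lra.
have [a1a2 a2m] : a1 < a2 /\ a2 < m by rewrite /a2; split; lra.
have [Mb2 b2b1] : M < b2 /\ b2 < b1 by rewrite /b2; split; lra.
have [F HF] : exists F : R -> R, forall u, a1 < u < b1 -> is_derive u 1 F (k u)^-1.
  apply: (@antiderivative_exists (fun u => (k u)^-1) a b) => // u /Hk[k0 ck].
  by apply: continuousV => //; rewrite gt_eqF.
have mM : m <= M by rewrite ge_min le_max lexx.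
have a2b2 : a2 < b2 by apply: lt_trans a2m (le_lt_trans mM Mb2).
have in1 u : a2 <= u <= b2 -> a1 < u < b1.
  by move=> /andP[h1 h2]; rewrite (lt_le_trans a1a2)// (le_lt_trans h2).
have inab u : a2 <= u <= b2 -> a < u < b.
  by move=> /in1/andP[h1 h2]; rewrite (lt_trans aa1)// (lt_trans h2).
have dF u : a2 <= u <= b2 -> derivable F u 1 by move=> /in1/HF[].
have cF u : a2 <= u <= b2 -> {for u, continuous F}.
  by move=> /dF/derivable1_diffP/differentiable_continuous.
have cwF : {within `[a2, b2], continuous F}.
  by apply: continuous_in_subspaceT => u; rewrite inE /= in_itv/=; exact: cF.
have oc u : u \in `]a2, b2[ -> a2 <= u <= b2.
  by rewrite in_itv/= => /andP[/ltW-> /ltW->].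
have incF : {in `[a2, b2] &, {homo F : x y / x < y}}.
  apply: gtr0_derive1_lt_cc => // u /oc uab; first exact: dF.
  have [_ E] := HF _ (in1 _ uab).
  by rewrite derive1E E invr_gt0; have [] := Hk _ (inab _ uab).
pose tau u := xget a2 [set x | a2 <= x <= b2 /\ F x = u].
have tauF x : a2 <= x <= b2 -> tau (F x) = x.
  move=> xab; have [yab Ey] : a2 <= tau (F x) <= b2 /\ F (tau (F x)) = F x.
    by apply: (@xgetPex _ a2 [set z | a2 <= z <= b2 /\ F z = F x]); exists x.
  case: (ltgtP (tau (F x)) x) => // h.
    by have := incF _ _ _ _ h; rewrite !in_itv/= => /(_ yab xab); rewrite Ey ltxx.
  by have := incF _ _ _ _ h; rewrite !in_itv/= => /(_ xab yab); rewrite Ey ltxx.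
have FI u : F a2 < u < F b2 -> exists2 x, a2 < x < b2 & F x = u.
  move=> /andP[h1 h2].
  have [|x] := @IVT R F a2 b2 u (ltW a2b2) cwF.
    by rewrite ge_min (ltW h1)/= le_max (ltW h2) orbT.
  rewrite in_itv/= => /andP[h3 h4] E; exists x => //.
  rewrite !lt_neqAle h3 h4 !andbT; apply/andP; split; apply/eqP => e.
    by move: h1; rewrite e E ltxx.
  by move: h2; rewrite -e E ltxx.
exists tau, (F a2), (F b2); split.
  move=> u /FI[x xab <-]; have /andP[/ltW h1 /ltW h2] := xab.
  have xab' : a2 <= x <= b2 by rewrite h1.
  rewrite (tauF _ xab'); split; first exact: inab.
  have [k0 _] := Hk _ (inab _ xab').
  rewrite -[k x]invrK; apply: is_derive_inverse.
  - have := @near_in_itvoo R a2 b2 x; rewrite in_itv/= => /(_ xab).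
    by apply: filterS => z /oc; exact: tauF.
  - have := @near_in_itvoo R a2 b2 x; rewrite in_itv/= => /(_ xab).
    by apply: filterS => z /oc; exact: cF.
  - exact: HF (in1 _ xab').
  - by rewrite invr_neq0// gt_eqF.
have sab : a2 < s < b2.
  by rewrite (lt_le_trans a2m) ?ge_min ?lexx// (le_lt_trans _ Mb2)// le_max lexx.
have tab : a2 < t < b2.
  by rewrite (lt_le_trans a2m) ?ge_min ?lexx ?orbT// (le_lt_trans _ Mb2)// le_max lexx orbT.
have FM x : a2 < x < b2 -> F a2 < F x < F b2.
  move=> /andP[h1 h2]; apply/andP; split; apply: incF => //; rewrite in_itv/= ?lexx ?(ltW a2b2)//.
    by rewrite (ltW h1) (ltW h2).
  by rewrite (ltW h1) (ltW h2).
have w x : a2 < x < b2 -> a2 <= x <= b2 by move=> /andP[/ltW-> /ltW->].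
by exists (F s), (F t); split; [exact: FM|exact: FM|exact/tauF/w|exact/tauF/w].
Qed.

End TimeChange.

(** * Directional derivatives of pairs and of the dot product *)

Section Calculus.
Context {R : realType}.

Lemma derive_affine (V W : normedModType R) (f : V -> W) x v w :
  (forall h : R, f (h *: v + x) = h *: w + f x) -> 'D_v f x = w.
Proof.
move=> H; apply: cvg_lim => //; apply: cvg_near_cst; near=> h.
have h0 : h != 0 by near: h; exact: nbhs_dnbhs_neq.
by rewrite /= H addrK scalerA mulVf// scale1r.
Unshelve. all: by end_near. Qed.

Lemma deriveDl (V W : normedModType R) (f : V -> W) x u v :
  differentiable f x -> 'D_(u + v) f x = 'D_u f x + 'D_v f x.
Proof. by move=> df; rewrite (deriveE _ df) linearD (deriveE u df) (deriveE v df). Qed.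

Lemma derive_linear_sum (V W : normedModType R) (f : V -> W) x n (c : 'I_n -> R)
    (e : 'I_n -> V) : differentiable f x ->
  'D_(\sum_i c i *: e i) f x = \sum_i c i *: 'D_(e i) f x.
Proof.
move=> df; rewrite (deriveE _ df) linear_sum; apply: eq_bigr => i _.
by rewrite linearZ (deriveE _ df).
Qed.

Lemma is_diff_fst (V W : normedModType R) (z : V * W) : is_diff z fst fst.
Proof.
have cf : continuous (fst : V * W -> V) by move=> ?; exact: cvg_fst.
apply: DiffDef; first exact: (linear_differentiable (f := fst)).
by rewrite (diff_lin (f := fst)).
Qed.

Lemma is_diff_snd (V W : normedModType R) (z : V * W) : is_diff z snd snd.
Proof.
have cf : continuous (snd : V * W -> W) by move=> ?; exact: cvg_snd.
apply: DiffDef; first exact: (linear_differentiable (f := snd)).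
by rewrite (diff_lin (f := snd)).
Qed.

Lemma derive_fst (V W : normedModType R) (z w : V * W) : 'D_w fst z = w.1.
Proof. by have [d E] := is_diff_fst z; rewrite (deriveE w d) E. Qed.

Lemma derive_snd (V W : normedModType R) (z w : V * W) : 'D_w snd z = w.2.
Proof. by have [d E] := is_diff_snd z; rewrite (deriveE w d) E. Qed.

Lemma derive_fst_comp (U V W : normedModType R) (f : V -> W) (z w : V * U) :
  differentiable f z.1 -> differentiable (f \o fst) z /\
  'D_w (f \o fst) z = 'D_w.1 f z.1.
Proof.
move=> df; have [d _] := is_diff_fst z; split; first exact: differentiable_comp.
by rewrite (derive_comp _ d df) derive_fst.
Qed.

Lemma derive_pair (U V W : normedModType R) (f : U -> V) (g : U -> W) x v :
  differentiable f x -> differentiable g x ->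
  'D_v (fun y => (f y, g y)) x = ('D_v f x, 'D_v g x).
Proof.
move=> df dg; rewrite (deriveE _ (differentiable_pair df dg)) (diff_pair df dg)/=.
by rewrite (deriveE _ df) (deriveE _ dg).
Qed.

Lemma differentiable_entry (V : normedModType R) m n (f : V -> 'M[R]_(m, n)) x i j :
  differentiable f x -> differentiable (fun y => f y i j) x.
Proof.
move=> df; apply: (@differentiable_comp _ _ _ _ f (fun M : 'M[R]_(m, n) => M i j)) => //.
exact: differentiable_coord.
Qed.

Definition dot n (x y : 'rV[R]_n) : R := \sum_k x 0 k * y 0 k.

Lemma dotC n (x y : 'rV[R]_n) : dot x y = dot y x.
Proof. by apply: eq_bigr => k _; rewrite mulrC. Qed.

Lemma dotE n (x y : 'rV[R]_n) : dot x y = (x *m y^T) 0 0.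
Proof. by rewrite mxE; apply: eq_bigr => k _; rewrite mxE. Qed.

Lemma dot_mulmx n m (x : 'rV[R]_m) (y : 'rV[R]_n) (A : 'M[R]_(m, n)) :
  dot (x *m A) y = dot x (y *m A^T).
Proof. by rewrite !dotE trmx_mul trmxK mulmxA. Qed.

Lemma dot_delta n (x : 'rV[R]_n) i : dot (delta_mx 0 i) x = x 0 i.
Proof.
rewrite /dot (bigD1 i)//= big1 ?addr0; first by rewrite mxE !eqxx mul1r.
by move=> j /negPf ji; rewrite mxE ji andbF mul0r.
Qed.

Lemma dot0r n (x : 'rV[R]_n) : dot x 0 = 0.
Proof. by rewrite dotE trmx0 mulmx0 mxE. Qed.

Lemma dotNr n (x y : 'rV[R]_n) : dot x (- y) = - dot x y.
Proof. by rewrite /dot -sumrN; apply: eq_bigr => k _; rewrite mxE mulrN. Qed.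

Lemma derive_dot (V : normedModType R) n (g h : V -> 'rV[R]_n) x v :
  differentiable g x -> differentiable h x ->
  'D_v (fun z => dot (g z) (h z)) x = dot ('D_v g x) (h x) + dot (g x) ('D_v h x).
Proof.
move=> dg dh.
have dgi i := differentiable_entry 0 i dg; have dhi i := differentiable_entry 0 i dh.
have -> : (fun z => dot (g z) (h z)) = \sum_i ((fun z => g z 0 i) * (fun z => h z 0 i)).
  by apply/funext => z; rewrite fct_sumE.
rewrite derive_sum; last by move=> i; apply/diff_derivable/differentiableM.
rewrite -big_split; apply: eq_bigr => i _.
rewrite (deriveM (diff_derivable (dgi i)) (diff_derivable (dhi i))).
rewrite (derive_mx (diff_derivable dg)) (derive_mx (diff_derivable dh)) !mxE.
by rewrite addrC mulrC.
Qed.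

End Calculus.

(** * Cotangent lifts in coordinates *)

Section CoordinateLift.
Context {R : realType} {n : nat}.
Implicit Types (f : 'rV[R]_n -> 'rV[R]_n) (D : set 'rV[R]_n).

(** The expression of [cotangent_lift] in canonical coordinates, as [local_cotangent_lift] shows;
    the analysis is done on this map between vector spaces. *)
Definition colift f (z : 'rV[R]_n * 'rV[R]_n) : 'rV[R]_n * 'rV[R]_n :=
  (f z.1, z.2 *m invmx (jacobian f z.1)^T).

Lemma open_setXT D : open D -> open (D `*` [set: 'rV[R]_n]).
Proof.
move=> oD; suff -> : D `*` [set: 'rV[R]_n] = fst @^-1` D.
  by apply: open_comp => // z _; exact: cvg_fst.
by apply/seteqP; split=> [z []|z Dz].
Qed.

Lemma Ck_on_fst (W : normedModType R) k D (f : 'rV[R]_n -> W) : open D ->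
  Ck_on k D f ->
  Ck_on k (D `*` [set: 'rV[R]_n]) (fun z : 'rV[R]_n * 'rV[R]_n => f z.1).
Proof.
move=> oD Cf; apply: (@Ck_on_sub _ _ _ _ _ (fst @^-1` D)); first by move=> z [].
apply: (@Ck_on_prelin R ('rV[R]_n * 'rV[R]_n)%type W 'rV[R]_n k D f fst) => //.
  by apply: open_comp => // z _; exact: cvg_fst.
by move=> z; exact: cvg_fst.
Qed.

Lemma Ck_on_snd k (E : set ('rV[R]_n * 'rV[R]_n)) : Ck_on k E snd.
Proof. by apply: (@Ck_on_lin _ _ _ _ _ snd) => z; exact: cvg_snd. Qed.

Lemma Ck_on_comp_pair (V : normedModType R) k (D : set V)
    (E : set ('rV[R]_n * 'rV[R]_n)) (f : V -> 'rV[R]_n * 'rV[R]_n)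
    (g : 'rV[R]_n * 'rV[R]_n -> R) :
  open D -> (forall x, D x -> E (f x)) ->
  Ck_on k D f -> Ck_on k E g -> Ck_on k D (g \o f).
Proof.
(* The 2n coordinate vectors of the product and their coordinate functions, in the form expected by
   [Ck_on_comp]. *)
pose e (i : 'I_n + 'I_n) : 'rV[R]_n * 'rV[R]_n :=
  match i with inl i => (delta_mx 0 i, 0) | inr i => (0, delta_mx 0 i) end.
pose l (i : 'I_n + 'I_n) (w : 'rV[R]_n * 'rV[R]_n) : R :=
  match i with inl i => w.1 0 i | inr i => w.2 0 i end.
move=> oD; apply: (@Ck_on_comp _ _ _ _ _ _ _ _ _ e l) => //.
  move=> [] i j h Ch; apply: Ck_on_entry => //.
    by apply: (@Ck_on_postlin _ _ _ _ _ _ h fst) => // z; exact: cvg_fst.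
  by apply: (@Ck_on_postlin _ _ _ _ _ _ h snd) => // z; exact: cvg_snd.
move=> w; rewrite big_sumType/= [RHS]surjective_pairing /= !raddf_sum/=.
rewrite -!row_sum_delta !big1 ?addr0 ?add0r -?surjective_pairing// => i _;
  by rewrite scaler0.
Qed.

Lemma Ck_on_jacobian k D f i j : open D -> Ck_on k.+1 D f ->
  Ck_on k D (fun q => jacobian f q i j).
Proof.
move=> oD [df Cf]; apply: Ck_on_eq (Ck_on_entry 0 j oD (Cf (delta_mx 0 i))) => //.
by move=> q Dq; rewrite jacobian_entry//; exact: df.
Qed.

(** One order of differentiability is spent on the Jacobian in the momentum component. *)
Lemma Ck_on_colift k D f : open D -> Ck_on k.+1 D f ->
  (forall q, D q -> jacobian f q \in unitmx) ->
  Ck_on k (D `*` setT) (colift f).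
Proof.
move=> oD Cf uf; have oDT := open_setXT oD.
apply: Ck_on_pair => //; first by apply: Ck_on_fst => //; exact: Ck_onW.
apply: Ck_on_row => // j.
have H : Ck_on k (D `*` setT) (fun z : 'rV[R]_n * 'rV[R]_n =>
    \sum_i z.2 0 i * invmx (jacobian f z.1)^T i j).
  apply: Ck_on_sum => // i; apply: Ck_on_mul => //.
    by apply: Ck_on_entry => //; exact: Ck_on_snd.
  apply: (@Ck_on_fst R^o k D (fun q => invmx (jacobian f q)^T i j)) => //.
  apply: (@Ck_on_invmx _ _ _ _ _ (fun q => (jacobian f q)^T)) => //.
    by move=> q Dq; rewrite unitmx_tr; exact: uf.
  move=> i' j'; apply: Ck_on_eq (@Ck_on_jacobian k D f j' i' oD Cf) => // q _.
  by rewrite [RHS]mxE.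
by apply: Ck_on_eq H => // z _; rewrite mxE.
Qed.

(** This map inverts the momentum component of [colift f]: it recovers a covector at y.1 from its
    image. *)
Lemma Ck_on_adjoint k D f : open D -> Ck_on k.+1 D f ->
  Ck_on k (D `*` setT)
    (fun y : 'rV[R]_n * 'rV[R]_n => y.2 *m (jacobian f y.1)^T).
Proof.
move=> oD Cf; have oDT := open_setXT oD.
apply: Ck_on_row => // j.
have H : Ck_on k (D `*` setT) (fun y : 'rV[R]_n * 'rV[R]_n =>
    \sum_i y.2 0 i * jacobian f y.1 j i).
  apply: Ck_on_sum => // i; apply: Ck_on_mul => //.
    by apply: Ck_on_entry => //; exact: Ck_on_snd.
  apply: (@Ck_on_fst R^o k D (fun q => jacobian f q j i)) => //.
  exact: Ck_on_jacobian.
by apply: Ck_on_eq H => // y _; rewrite mxE; apply: eq_bigr => i _; rewrite [in RHS]mxE.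
Qed.

(** Regularity jointly in base point and vector, needed for the velocity of an image arc. *)
Lemma Ck_on_pushforward k D f : open D -> Ck_on k.+1 D f ->
  Ck_on k (D `*` setT)
    (fun y : 'rV[R]_n * 'rV[R]_n => y.2 *m jacobian f y.1).
Proof.
move=> oD Cf; have oDT := open_setXT oD.
apply: Ck_on_row => // j.
have H : Ck_on k (D `*` setT) (fun y : 'rV[R]_n * 'rV[R]_n =>
    \sum_i y.2 0 i * jacobian f y.1 i j).
  apply: Ck_on_sum => // i; apply: Ck_on_mul => //.
    by apply: Ck_on_entry => //; exact: Ck_on_snd.
  apply: (@Ck_on_fst R^o k D (fun q => jacobian f q i j)) => //.
  exact: Ck_on_jacobian.
by apply: Ck_on_eq H => // y _; rewrite [RHS]mxE.
Qed.

Section AtPoint.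
Variables (D : set 'rV[R]_n) (f : 'rV[R]_n -> 'rV[R]_n).
Hypotheses (oD : open D) (Cf : Ck_on 2 D f).
Hypothesis uf : forall q, D q -> jacobian f q \in unitmx.
Variable z : 'rV[R]_n * 'rV[R]_n.
Hypothesis Dz : D z.1.

Let P (w : 'rV[R]_n * 'rV[R]_n) := w.2 *m invmx (jacobian f w.1)^T.

Lemma differentiable_colift : differentiable (colift f) z.
Proof. by have [d _] := Ck_on_colift oD Cf uf; exact: d. Qed.

Let dP : differentiable P z.
Proof.
apply: (@differentiable_comp _ _ _ _ (colift f) snd); first exact: differentiable_colift.
by have [] := is_diff_snd (colift f z).
Qed.

Let df q : D q -> differentiable f q. Proof. by have [d _] := Cf; exact: d. Qed.

Let dDf v q : D q -> differentiable (fun q => 'D_v f q) q.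
Proof. by have [_ /(_ v) [d _]] := Cf; exact: d. Qed.

Lemma derive_colift w : 'D_w (colift f) z = ('D_w.1 f z.1, 'D_w P z).
Proof.
have [d1 E1] := @derive_fst_comp R 'rV[R]_n _ _ f z w (df Dz).
by rewrite (derive_pair w d1 dP) E1.
Qed.

Let derive_lift_vertical p : 'D_(0, p) P z = p *m invmx (jacobian f z.1)^T.
Proof.
by apply: derive_affine => h; rewrite /P /= scaler0 add0r mulmxDl scalemxAl.
Qed.

Lemma derive_colift_vertical p :
  'D_(0, p) (colift f) z = (0, p *m invmx (jacobian f z.1)^T).
Proof. by rewrite derive_colift derive_lift_vertical/= derive0. Qed.

(** The differential of a lift is block triangular: [u] solves for the position component, and the
    vertical vector [p] corrects the momentum component that [u] produces. *)
Lemma derive_colift_surjective w' : exists w, 'D_w (colift f) z = w'.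
Proof.
have uz := uf Dz; have dz := df Dz; have d := differentiable_colift.
pose u := w'.1 *m invmx (jacobian f z.1).
pose p := (w'.2 - 'D_(u, 0) P z) *m (jacobian f z.1)^T.
exists ((u, 0) + (0, p)).
rewrite (deriveDl _ _ d) derive_colift_vertical derive_colift/=.
rewrite (deriveEjacobian u dz) mulmxKV// mulmxK ?unitmx_tr//.
by rewrite [LHS]surjective_pairing/= addr0 addrC subrK -surjective_pairing.
Qed.

(* Obtained by differentiating [dot ('D_v f q) (P (q, p)) = dot v p]. *)
Lemma derive_duality v w :
  dot ('D_w.1 (fun q => 'D_v f q) z.1) (P z) + dot ('D_v f z.1) ('D_w P z)
  = dot v w.2.
Proof.
have oDT := open_setXT oD.
have [d1 E1] := @derive_fst_comp R 'rV[R]_n _ _ (fun q => 'D_v f q) z w (dDf v Dz).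
rewrite -E1 -(derive_dot w d1 dP).
have dsnd : differentiable (snd : 'rV[R]_n * 'rV[R]_n -> _) z by have [] := is_diff_snd z.
have -> : dot v w.2 = 'D_w (fun z => dot v z.2) z.
  rewrite (derive_dot (g := fun=> v) w (differentiable_cst _ _) dsnd) derive_snd derive_cst.
  by rewrite [dot 0 _]dotC dot0r add0r.
apply: near_eq_derive; apply: (@open_nbhs_eq _ _ (D `*` setT)) => // y [Dy _].
have dy := df Dy.
rewrite /P /= (deriveEjacobian v dy) dot_mulmx mulmxKV// unitmx_tr.
exact: uf.
Qed.

End AtPoint.

(** With [f] only C^1 the lift is merely continuous, so [local_surjection] is applied to [f] in the
    base. In the fibre the preimage of a covector is explicit: it is given by the adjoint [g], whose
    continuity keeps it near [z.2]. *)
Lemma local_surjection_colift D f (z : 'rV[R]_n * 'rV[R]_n) N :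
  open D -> Ck_on 1 D f -> (forall q, D q -> jacobian f q \in unitmx) -> D z.1 ->
  nbhs z N -> nbhs (colift f z) (colift f @` N).
Proof.
move=> oD Cf uf Dz [[A B] /= [nA nB] ABN].
pose g (y : 'rV[R]_n * 'rV[R]_n) := y.2 *m (jacobian f y.1)^T.
have Cg := Ck_on_adjoint oD Cf : Ck_on 0 _ g.
have gz : g (z.1, (colift f z).2) = z.2.
  by rewrite /g /= mulmxKV// unitmx_tr; exact: uf.
have : nbhs (z.1, (colift f z).2) (g @^-1` B).
  by apply: (Cg (z.1, (colift f z).2)); [|rewrite gz].
move=> [[A' B'] /= [nA' nB'] ABg].
have nD : nbhs z.1 D by exact: open_nbhs_nbhs.
have reg : \forall y \near z.1, differentiable f y /\ jacobian f y \in unitmx.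
  by apply: filterS nD => y Dy; split; [have [d _] := Cf; exact: d|exact: uf].
have nI := local_surjection reg (filterI (filterI nA nA') nD).
exists (f @` (A `&` A' `&` D), B'); first by split; [exact: nI|exact: nB'].
move=> [q' p'] /= [[q [[Aq A'q] Dq] <-] B'p].
exists (q, g (q, p')); first by apply: ABN; split => //; exact: (ABg (q, p')).
by rewrite /colift /g /= mulmxK// unitmx_tr; exact: uf.
Qed.

End CoordinateLift.

(** * Lifts carry Hamiltonian fields to Hamiltonian fields *)

Section Symplectic.
Context {R : realType}.
Local Notation V := 'rV[R]_2.

Lemma hamiltonian_fieldE (H : V * V -> R) z : differentiable H z ->
  hamiltonian_field H z =
  (\row_i 'D_(0, delta_mx 0 i) H z, - \row_i 'D_(delta_mx 0 i, 0) H z).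
Proof.
move=> dH; congr (_, - _); apply/rowP => i; rewrite !mxE.
  exact: esym (deriveE _ dH).
exact: esym (deriveE _ dH).
Qed.

Lemma derive_momentum_row (H : V * V -> R) z p : differentiable H z ->
  'D_(0, p) H z = dot p (\row_i 'D_(0, delta_mx 0 i) H z).
Proof.
move=> dH; have -> : (0, p) = \sum_i p 0 i *: ((0, delta_mx 0 i) : V * V).
  rewrite [RHS]surjective_pairing !raddf_sum/= -row_sum_delta big1// => i _.
  by rewrite scaler0.
rewrite (derive_linear_sum _ _ dH); apply: eq_bigr => i _; by rewrite mxE.
Qed.

Lemma derive_position_row (H : V * V -> R) z q : differentiable H z ->
  'D_(q, 0) H z = dot q (\row_i 'D_(delta_mx 0 i, 0) H z).
Proof.
move=> dH; have -> : (q, 0) = \sum_i q 0 i *: ((delta_mx 0 i, 0) : V * V).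
  rewrite [RHS]surjective_pairing !raddf_sum/= -row_sum_delta big1// => i _.
  by rewrite scaler0.
rewrite (derive_linear_sum _ _ dH); apply: eq_bigr => i _; by rewrite mxE.
Qed.

Lemma derive_swap_row n (D : set V) (f : V -> 'rV[R]_n) x u v :
  open D -> Ck_on 2 D f -> D x -> 'D_u (fun q => 'D_v f q) x = 'D_v (fun q => 'D_u f q) x.
Proof.
move=> oD Cf Dx; have [df Cf1] := Cf.
have dDf w : differentiable (fun q => 'D_w f q) x by have [d _] := Cf1 w; exact: d.
apply/matrixP => i j.
have ent w w' : ('D_w (fun q => 'D_w' f q) x) i j = 'D_w (fun q => 'D_w' f q i j) x.
  by rewrite (derive_mx (diff_derivable (dDf w'))) mxE.
have e1 := ent u v; have e2 := ent v u; rewrite [LHS]e1 [RHS]e2.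
have E w : forall q, D q -> 'D_w f q i j = 'D_w (fun q => f q i j) q.
  by move=> q Dq; rewrite (derive_mx (diff_derivable (df _ Dq))) mxE.
have e3 := near_eq_derive u (open_nbhs_eq oD (E v) Dx).
have e4 := near_eq_derive v (open_nbhs_eq oD (E u) Dx).
rewrite [LHS]e3 [RHS]e4; exact: derive_swap oD (Ck_on_entry i j oD Cf) Dx.
Qed.

(* [colift f] is symplectic; the momentum component uses [derive_swap_row]. *)
Lemma derive_colift_hamiltonian (D : set V) f (H : V * V -> R) z :
  open D -> Ck_on 2 D f -> (forall q, D q -> jacobian f q \in unitmx) -> D z.1 ->
  differentiable H (colift f z) ->
  'D_(hamiltonian_field (H \o colift f) z) (colift f) z
  = hamiltonian_field H (colift f z).
Proof.
move=> oD Cf uf Dz dH.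
have dF := differentiable_colift oD Cf uf Dz.
have dK := differentiable_comp dF dH.
have dfz : differentiable f z.1 by have [d _] := Cf; exact: d.
pose J := jacobian f z.1; have uJ : J \in unitmx := uf _ Dz.
pose K := H \o colift f.
pose X1 : V := \row_i 'D_(0, delta_mx 0 i) K z.
pose X2 : V := - \row_i 'D_(delta_mx 0 i, 0) K z.
pose P := (colift f z).2.
have KE : hamiltonian_field K z = (X1, X2) by rewrite (hamiltonian_fieldE dK).
have DK w : 'D_w K z = 'D_('D_w (colift f) z) H (colift f z) by exact: derive_comp.
have Dp p : 'D_(0, p) H (colift f z) = dot (p *m J^T) X1.
  rewrite -(derive_momentum_row _ dK) DK (derive_colift_vertical oD Cf uf Dz).
  by rewrite mulmxK// unitmx_tr.
rewrite KE (hamiltonian_fieldE dH) (derive_colift oD Cf uf Dz).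
set Y := 'D_(X1, X2) _ z.
congr (_, _); apply/rowP => i; rewrite ![in RHS]mxE.
  rewrite Dp -dot_delta (deriveEjacobian _ dfz) -/J dotC dot_mulmx dotC.
  done.
(* The vector that the differential of [f] sends to the i-th basis vector, so that pairing with its
   image extracts the i-th momentum. *)
pose u : V := delta_mx 0 i *m invmx J.
have Du : 'D_u f z.1 = delta_mx 0 i by rewrite (deriveEjacobian _ dfz) mulmxKV.
set S := 'D_(u, 0) (fun w : V * V => w.2 *m invmx (jacobian f w.1)^T) z.
(* [E1] and [E2] are [derive_duality] for the vector [u] with direction [(X1, X2)] and for the
   vector [X1] with direction [(u, 0)]. They leave the mixed second derivatives of [f] along [u] and
   [X1] in opposite orders, and these are equal. *)
have E1 : Y 0 i = dot u X2 - dot ('D_X1 (fun q => 'D_u f q) z.1) P.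
  have := derive_duality oD Cf uf Dz u (X1, X2).
  rewrite /= Du dot_delta -/Y => E.
  by apply: (canRL (addrK _)); rewrite addrC; exact: E.
have E2 : dot (S *m J^T) X1 = - dot ('D_u (fun q => 'D_X1 f q) z.1) P.
  have := derive_duality oD Cf uf Dz X1 (u, 0).
  rewrite /= -/S dot0r (deriveEjacobian _ dfz) -/J dot_mulmx => E.
  by apply/eqP; rewrite [X in X == _]dotC -addr_eq0 addrC; apply/eqP.
have E3 : 'D_(u, 0) K z = 'D_(delta_mx 0 i, 0) H (colift f z) + dot (S *m J^T) X1.
  rewrite DK (derive_colift oD Cf uf Dz) -/S [(u, 0).1]/= Du -Dp.
  rewrite -(deriveDl _ _ dH).
  by rewrite [X in _ = 'D_X _ _]surjective_pairing /= addr0 add0r.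
have E4 : 'D_(u, 0) K z = - dot u X2.
  by rewrite (derive_position_row _ dK) /X2 dotNr opprK.
rewrite E1 (derive_swap_row _ _ oD Cf Dz).
have -> : 'D_(delta_mx 0 i, 0) H (colift f z) = - dot u X2 - dot (S *m J^T) X1.
  by rewrite -E4 E3 addrK.
by rewrite E2; ring.
Qed.

End Symplectic.

(** * Charts *)

(** [A] and [A'] are the two changes between a source chart and the chosen one, [B'] and [B] those
    in the target, [T] the tangent map in chosen charts and [J] the Jacobian in the given ones.
    Covectors move by inverse transposes, so the changes of chart cancel. *)
Lemma covector_change_basis (R : comUnitRingType) n (p : 'rV[R]_n)
    (A A' T B' B J : 'M[R]_n) :
  A *m A' = 1%:M -> T \in unitmx -> B' *m B = 1%:M -> J \in unitmx ->
  J = A *m T *m B' ->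
  p *m A'^T *m invmx T^T *m B^T = p *m invmx J^T.
Proof.
move=> AA uT BB uJ EJ; have uJT : J^T \in unitmx by rewrite unitmx_tr.
have uTT : T^T \in unitmx by rewrite unitmx_tr.
apply: (can_inj (mulmxK uJT)); rewrite (mulmxKV uJT) EJ !trmx_mul !mulmxA.
rewrite -[_ *m B^T *m _]mulmxA -trmx_mul BB trmx1 mulmx1 (mulmxKV uTT).
by rewrite -mulmxA -trmx_mul AA trmx1 mulmx1.
Qed.

Section Charts.
Context {R : realType}.
Implicit Types M : surface R.

Lemma open_preimage_on (T U : topologicalType) (f : T -> U) A B :
  open A -> (forall x, A x -> {for x, continuous f}) -> open B ->
  open (A `&` f @^-1` B).
Proof.
move=> oA cf oB; rewrite openE => x [Ax Bx].
apply: filterI; first exact: open_nbhs_nbhs.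
by apply: (cf x Ax); exact: open_nbhs_nbhs.
Qed.

Section OneChart.
Variables (M : surface R) (c : chart R M).
Hypothesis ac : atlas M c.

Lemma transition_differentiable (c' : chart R M) x : atlas M c' -> dom c x -> dom c' x ->
  differentiable (coord c' \o param c) (coord c x).
Proof.
move=> ac' cx c'x; have [d _] := atlas_smooth ac ac' 1%N.
by apply: d; split; [exact: coord_img|rewrite /= coordK].
Qed.

Lemma transition_near_id (c' : chart R M) x : dom c x -> dom c' x ->
  \forall q \near coord c x, (coord c \o param c') ((coord c' \o param c) q) = q.
Proof.
move=> cx c'x.
have oD : open (img c `&` param c @^-1` dom c').
  by apply: open_preimage_on; [exact: img_open|exact: param_continuous|exact: dom_open].
have Dx : (img c `&` param c @^-1` dom c') (coord c x).
  by split; [exact: coord_img|rewrite /= coordK].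
apply: filterS (open_nbhs_nbhs (conj oD Dx)) => q [iq c'q] /=.
by rewrite coordK// paramK.
Qed.

Lemma jac_from_to x : dom c x -> jac_from_chart c x *m jac_to_chart c x = 1%:M.
Proof.
move=> cx; have ca := chart_at_atlas x; have ax := chart_at_dom x.
have d1 := transition_differentiable ca cx ax.
have d2 : differentiable (coord c \o param (chart_at x))
    ((coord (chart_at x) \o param c) (coord c x)).
  rewrite /= coordK//; have [d _] := atlas_smooth ca ac 1%N.
  by apply: d; split; [exact: coord_img|rewrite /= coordK].
have E := jacobian_comp d1 d2.
have N := transition_near_id cx ax.
have I := near_eq_jacobian N (differentiable_comp d1 d2).
rewrite jacobian_id in I.
rewrite /jac_from_chart /jac_to_chart.
by rewrite /= coordK// in E; rewrite -E -I.
Qed.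

Lemma jac_to_from x : dom c x -> jac_to_chart c x *m jac_from_chart c x = 1%:M.
Proof. by move=> cx; apply: mulmx1C; exact: jac_from_to. Qed.

Lemma cocoordK z : dom c z.1 -> coparam c (cocoord c z) = z.
Proof.
move=> cz; rewrite [RHS]surjective_pairing /coparam /cocoord /= coordK//.
by rewrite -mulmxA -trmx_mul jac_to_from// trmx1 mulmx1.
Qed.

Lemma coparamK z : img c z.1 -> cocoord c (coparam c z) = z.
Proof.
move=> cz; have dz : dom c (param c z.1) by exact: param_dom.
rewrite [RHS]surjective_pairing /coparam /cocoord /= paramK//.
by rewrite -mulmxA -trmx_mul jac_from_to// trmx1 mulmx1.
Qed.

End OneChart.

Section LocalMap.
Variables (M M' : surface R) (phi : M -> M').
Hypothesis sphi : smooth_map phi.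

Definition local_map (c : chart R M) (c' : chart R M') : 'rV[R]_2 -> 'rV[R]_2 :=
  coord c' \o phi \o param c.

Definition local_dom (c : chart R M) (c' : chart R M') : set 'rV[R]_2 :=
  img c `&` param c @^-1` (phi @^-1` dom c').

Lemma open_local_dom c c' : open (local_dom c c').
Proof.
apply: open_preimage_on; [exact: img_open|exact: param_continuous|].
by apply: open_comp; [move=> x _; exact: sphi.1|exact: dom_open].
Qed.

Lemma local_dom_coord c c' x : dom c x -> dom c' (phi x) -> local_dom c c' (coord c x).
Proof. by move=> cx cx'; split; [exact: coord_img|rewrite /= coordK]. Qed.

Lemma Ck_on_local_map k c c' : atlas M c -> atlas M' c' ->
  Ck_on k (local_dom c c') (local_map c c').
Proof. by move=> ac ac'; exact: sphi.2. Qed.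

Lemma differentiable_local_map c c' x : atlas M c -> atlas M' c' ->
  dom c x -> dom c' (phi x) -> differentiable (local_map c c') (coord c x).
Proof.
move=> ac ac' cx cx'; have [d _] := @Ck_on_local_map 1 _ _ ac ac'.
exact/d/local_dom_coord.
Qed.

(** Near [coord c x] the expression of [phi] in [c], [c'] factors through its expression in [a],
    [a'], so the chain rule applies. *)
Lemma jacobian_change_charts a a' c c' x : atlas M a -> atlas M' a' ->
  atlas M c -> atlas M' c' -> dom a x -> dom a' (phi x) -> dom c x -> dom c' (phi x) ->
  jacobian (local_map c c') (coord c x) =
  jacobian (coord a \o param c) (coord c x) *m jacobian (local_map a a') (coord a x)
    *m jacobian (coord c' \o param a') (coord a' (phi x)).
Proof.
move=> Aa Aa' Ac Ac' ax a'x cx c'x.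
have d1 := transition_differentiable Ac Aa cx ax.
have d2 := differentiable_local_map Aa Aa' ax a'x.
have d3 := transition_differentiable Aa' Ac' a'x c'x.
have e1 : (coord a \o param c) (coord c x) = coord a x by rewrite /= coordK.
have e2 : local_map a a' (coord a x) = coord a' (phi x) by rewrite /local_map /= coordK.
have d2' := d2; rewrite -e1 in d2'.
have d12 := differentiable_comp d1 d2'.
have d3' : differentiable (coord c' \o param a')
    ((local_map a a' \o (coord a \o param c)) (coord c x)).
  by rewrite [X in differentiable _ X](_ : _ = coord a' (phi x))// -e2 /= coordK.
have E12 := jacobian_comp d1 d2'; have E := jacobian_comp d12 d3'.
rewrite E12 e1 in E.
have e3 : (local_map a a' \o (coord a \o param c)) (coord c x) = coord a' (phi x).
  by rewrite -e2 /= coordK.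
rewrite e3 in E; rewrite -E.
have oD : open (local_dom c c' `&` (img c `&` param c @^-1` (dom a `&` phi @^-1` dom a'))).
  apply: openI; first exact: open_local_dom.
  apply: open_preimage_on; [exact: img_open|exact: param_continuous|].
  apply: openI; first exact: dom_open.
  by apply: open_comp; [move=> y _; exact: sphi.1|exact: dom_open].
have Dx : (local_dom c c' `&` (img c `&` param c @^-1` (dom a `&` phi @^-1` dom a'))) (coord c x).
  by split; [exact: local_dom_coord|split; [exact: coord_img|rewrite /= coordK]].
apply: near_eq_jacobian; last exact: differentiable_comp d12 d3'.
apply: filterS (open_nbhs_nbhs (conj oD Dx)) => q [[iq c'q] [_ [aq a'q]]].
by rewrite /local_map /= (coordK aq) (coordK a'q).
Qed.

Lemma jacobian_local_map c c' x : atlas M c -> atlas M' c' -> dom c x -> dom c' (phi x) ->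
  jacobian (local_map c c') (coord c x) =
  jac_from_chart c x *m tangent_map phi x *m jac_to_chart c' (phi x).
Proof.
move=> ac ac' cx cx'.
exact: (jacobian_change_charts (chart_at_atlas x) (chart_at_atlas (phi x)) ac ac'
  (chart_at_dom x) (chart_at_dom (phi x)) cx cx').
Qed.

Hypothesis uphi : forall x, tangent_map phi x \in unitmx.

Lemma unit_jacobian_local_map c c' q : atlas M c -> atlas M' c' ->
  local_dom c c' q -> jacobian (local_map c c') q \in unitmx.
Proof.
move=> ac ac' [iq cq']; rewrite -(paramK iq).
have cq : dom c (param c q) by exact: param_dom.
have unit_mul (A B C : 'M[R]_2) : A \in unitmx -> B \in unitmx -> C \in unitmx ->
    A *m B *m C \in unitmx by rewrite !unitmx_mul => -> -> ->.
have E := jacobian_local_map ac ac' cq cq'; rewrite E; apply: unit_mul.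
- exact: (mulmx1_unit (jac_to_from ac cq)).2.
- exact: uphi.
- exact: (mulmx1_unit (jac_to_from ac' cq')).1.
Qed.

Lemma local_cotangent_lift c c' z : atlas M c -> atlas M' c' ->
  local_dom c c' z.1 ->
  cocoord c' (cotangent_lift phi (coparam c z)) = colift (local_map c c') z.
Proof.
move=> ac ac' Dz; have [iz cz'] := Dz.
have cz : dom c (param c z.1) by exact: param_dom.
congr (_, _).
have uJ := unit_jacobian_local_map ac ac' Dz.
have E := jacobian_local_map ac ac' cz cz'; rewrite (paramK iz) in E.
exact: (covector_change_basis _ (jac_from_to ac cz) (uphi _) (jac_to_from ac' cz') uJ E).
Qed.

End LocalMap.
End Charts.

(** * Energy *)

(** It identifies the dual metric in a chart with the inverse of the Gram matrix in that chart, the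
    matrix whose smoothness [metric_smooth] provides. *)
Lemma dual_form_change_basis (R : comUnitRingType) n (A A' g : 'M[R]_n) :
  A *m A' = 1%:M -> g \in unitmx ->
  A *m g *m A^T \in unitmx /\ A'^T *m invmx g *m A' = invmx (A *m g *m A^T).
Proof.
move=> AA ug; have AA' := mulmx1C AA.
have E : A *m g *m A^T *m (A'^T *m invmx g *m A') = 1%:M.
  by rewrite !mulmxA -[_ *m A^T *m _]mulmxA -trmx_mul AA' trmx1 mulmx1 (mulmxK ug) AA.
have [uG _] := mulmx1_unit E; split => //.
by rewrite -[RHS]mulmx1 -E (mulKmx uG).
Qed.

Section Energy.
Context {R : realType}.

Lemma form2Z (A : 'M[R]_2) a u : form2 A (a *: u) (a *: u) = a ^+ 2 * form2 A u u.
Proof.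
by rewrite /form2 linearZ/= -scalemxAl -scalemxAr -scalemxAl scalerA [LHS]mxE expr2.
Qed.

Lemma form2_mulmx (A T : 'M[R]_2) u v :
  form2 A (u *m T) (v *m T) = form2 (T *m A *m T^T) u v.
Proof. by rewrite /form2 trmx_mul !mulmxA. Qed.

Lemma matrix_form2_eq (A B : 'M[R]_2) :
  (forall u v, form2 A u v = form2 B u v) -> A = B.
Proof.
move=> H; apply/matrixP => i j; have := H (delta_mx 0 i) (delta_mx 0 j).
by rewrite /form2 -!rowE !trmx_delta -!colE !mxE.
Qed.

Section Riemannian.
Variable M : riemannian_surface R.

Lemma gram_unit (x : M) : gram x \in unitmx.
Proof.
rewrite -row_free_unit -kermx_eq0; apply/rowV0P => u /sub_kermxP ug.
apply/eqP; apply/negP => /negP u0; have := metric_pos x u0.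
by rewrite /form2 ug mul0mx mxE ltxx.
Qed.

Lemma form2_invmx_gram (x : M) u :
  form2 (invmx (gram x)) u u = form2 (gram x) (u *m invmx (gram x)) (u *m invmx (gram x)).
Proof.
by rewrite form2_mulmx trmx_inv metric_sym (mulVmx (gram_unit x)) mul1mx.
Qed.

Lemma dual_metric_gt0 (x : M) u : u != 0 -> 0 < form2 (invmx (gram x)) u u.
Proof.
move=> u0; rewrite form2_invmx_gram; apply: metric_pos.
apply: contraNneq u0 => e; rewrite -(mulmxKV (gram_unit x) u).
by rewrite e mul0mx.
Qed.

Lemma dual_metric_ge0 (x : M) u : 0 <= form2 (invmx (gram x)) u u.
Proof.
have [->|/(dual_metric_gt0 x)/ltW//] := eqVneq u 0.
by rewrite /form2 mul0mx mul0mx mxE.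
Qed.

End Riemannian.

Lemma conformal_gram (M M' : riemannian_surface R) (phi : M -> M') (x : M) :
  conformal phi -> exists2 lambda : R, 0 < lambda &
    tangent_map phi x *m gram (phi x) *m (tangent_map phi x)^T = lambda *: gram x.
Proof.
move=> /(_ x)[lambda l0 H]; exists lambda => //; apply: matrix_form2_eq => u v.
rewrite -form2_mulmx [LHS]H /metric /form2.
by rewrite -scalemxAr -scalemxAl [RHS]mxE.
Qed.

Definition kinetic (S : billiard R) (z : cotangent S) : R :=
  2^-1 * form2 (invmx (gram z.1)) z.2 z.2.

Lemma kineticZ (S : billiard R) (x : S) a p :
  kinetic (x, a *: p) = a ^+ 2 * kinetic (x, p).
Proof. by rewrite /kinetic form2Z mulrCA. Qed.

Lemma kinetic_gt0 (S : billiard R) (x : S) p : p != 0 -> 0 < kinetic (x, p).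
Proof. by move=> p0; rewrite mulr_gt0// dual_metric_gt0. Qed.

Lemma kinetic_ge0 (S : billiard R) (z : cotangent S) : 0 <= kinetic z.
Proof. by rewrite mulr_ge0// dual_metric_ge0. Qed.

Lemma kinetic0 (S : billiard R) (x : S) : kinetic (x, 0) = 0.
Proof. by rewrite -(scale0r 0) kineticZ expr0n mul0r. Qed.

(** It provides a covector of energy e over each point where [force + e] is nonnegative: a fixed
    nonzero covector is rescaled. *)
Lemma kinetic_surj (S : billiard R) (x : S) e :
  0 <= e -> exists p, kinetic (x, p) = e.
Proof.
move=> e0; pose p : 'rV[R]_2 := delta_mx 0 0.
have p0 : p != 0.
  by apply/eqP => /rowP/(_ 0); rewrite !mxE /= => /eqP; rewrite oner_eq0.
have k0 := kinetic_gt0 x p0.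
exists (Num.sqrt (e / kinetic (x, p)) *: p).
by rewrite kineticZ sqr_sqrtr ?divr_ge0// ?ltW// divfK// gt_eqF.
Qed.

(* kappa is the inverse of the conformal factor. *)
Lemma conformal_kinetic (S S' : billiard R) (phi : S -> S') :
  (forall x, tangent_map phi x \in unitmx) -> conformal phi ->
  exists kappa : S -> R, forall x, 0 < kappa x /\
    forall p, kinetic (cotangent_lift phi (x, p)) = kappa x * kinetic (x, p).
Proof.
move=> uphi cphi.
suff H x : exists k : R, 0 < k /\
    forall p, kinetic (cotangent_lift phi (x, p)) = k * kinetic (x, p).
  by exists (fun x => sval (cid (H x))) => x; exact: svalP (cid (H x)).
have [l l0 E] := conformal_gram x cphi; have uT := uphi x.
have ug := gram_unit (phi x).
have uTt : (tangent_map phi x)^T \in unitmx by rewrite unitmx_tr.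
exists l^-1; split; first by rewrite invr_gt0.
move=> p; rewrite /kinetic /= form2_mulmx mulrCA; congr (_ * _).
have -> : invmx (tangent_map phi x)^T *m invmx (gram (phi x)) *m
    (invmx (tangent_map phi x)^T)^T = l^-1 *: invmx (gram x).
  have ul : l *: gram x \in unitmx by rewrite -E !unitmx_mul uT ug uTt.
  have -> : l^-1 *: invmx (gram x) = invmx (l *: gram x).
    by rewrite invmxZ// unitmxZ// unitfE gt_eqF.
  rewrite -E trmx_inv trmxK -[RHS]mul1mx.
  set A := _ *m _ *m _.
  set B := tangent_map phi x *m gram (phi x) *m (tangent_map phi x)^T.
  have uB : B \in unitmx by rewrite !unitmx_mul uT ug uTt.
  suff <- : A *m B = 1%:M by rewrite mulmxK.
  by rewrite /A /B !mulmxA (mulmxKV uT) (mulmxKV ug) mulVmx.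
by rewrite /form2 -scalemxAr -scalemxAl mxE.
Qed.

Lemma energyE (S : billiard R) z : energy S z = kinetic z - force z.1.
Proof. by []. Qed.

Section LocalEnergy.
Variables (S : billiard R) (c : chart R S).
Hypothesis ac : atlas S c.

Let chart_gram (q : 'rV[R]_2) : 'M[R]_2 :=
  jac_from_chart c (param c q) *m gram (param c q) *m (jac_from_chart c (param c q))^T.

Let chart_gram_dual q : img c q ->
  chart_gram q \in unitmx /\
  (jac_to_chart c (param c q))^T *m invmx (gram (param c q)) *m jac_to_chart c (param c q)
  = invmx (chart_gram q).
Proof.
move=> iq; have cx : dom c (param c q) by exact: param_dom.
exact: dual_form_change_basis (jac_from_to ac cx) (gram_unit _).
Qed.

Lemma kinetic_coparam z : img c z.1 ->
  kinetic (coparam c z) = 2^-1 * \sum_j (\sum_i z.2 0 i * invmx (chart_gram z.1) i j) * z.2 0 j.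
Proof.
move=> iz; have [_ E] := chart_gram_dual iz.
rewrite /kinetic /= form2_mulmx trmxK E /form2 !mxE; congr (_ * _).
by apply: eq_bigr => j _; rewrite mxE [X in _ * X = _]mxE.
Qed.

Lemma Ck_on_energy k : Ck_on k (img c `*` [set: 'rV[R]_2]) (energy S \o coparam c).
Proof.
have oi := @img_open _ _ c; have oD := open_setXT oi.
have H : Ck_on k (img c `*` [set: 'rV[R]_2]) (fun z : 'rV[R]_2 * 'rV[R]_2 =>
    2^-1 * (\sum_j (\sum_i z.2 0 i * invmx (chart_gram z.1) i j) * z.2 0 j)
     + (-1) * (@force R S \o param c) z.1).
  apply: Ck_on_add => //; (apply: Ck_on_mul => //; first exact: Ck_on_cst).
    apply: Ck_on_sum => // j; apply: Ck_on_mul => //; last first.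
      by apply: Ck_on_entry => //; exact: Ck_on_snd.
    apply: Ck_on_sum => // i; apply: Ck_on_mul => //.
      by apply: Ck_on_entry => //; exact: Ck_on_snd.
    apply: (@Ck_on_fst _ _ R^o k _ (fun q => invmx (chart_gram q) i j)) => //.
    apply: Ck_on_invmx => //; first by move=> q /chart_gram_dual[].
    by move=> i' j'; apply: Ck_on_entry => //; exact: metric_smooth.
  by apply: (@Ck_on_fst _ _ R^o) => //; exact: force_smooth.
apply: Ck_on_eq H => // z [iz _]; rewrite /= energyE kinetic_coparam//.
by rewrite mulN1r.
Qed.

Lemma differentiable_energy z : img c z.1 -> differentiable (energy S \o coparam c) z.
Proof. by move=> iz; have [d _] := Ck_on_energy 1; apply: d. Qed.

End LocalEnergy.

End Energy.

(** * Level points with positive kinetic energy are dense *)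

Section EnergyDensity.
Context {R : realType}.
Variables (S : billiard R) (c : chart R S).
Hypothesis ac : atlas S c.

Lemma derive_gt0_near (V : normedModType R) (f : V -> R) x u :
  differentiable f x -> 0 < 'D_u f x ->
  \forall t \near 0^'+, f x < f (t *: u + x).
Proof.
move=> df D0; have : (fun t : R => t^-1 *: (f (t *: u + x) - f x)) @ 0^' --> 'D_u f x.
  by have := diff_derivable (v := u) df; exact.
move=> /cvgrPdist_lt/(_ _ D0); rewrite /at_right !near_withinE.
apply: filterS => t Ht t0.
have := Ht _; rewrite gt_eqF// => /(_ isT).
rewrite ltr_distlC subrr => /andP[H _].
by move: H; rewrite -[_ *: _]/(_ * _) pmulr_rgt0 ?invr_gt0// subr_gt0.
Qed.

Lemma coparamZ q a (p : 'rV[R]_2) :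
  coparam c (q, a *: p) = ((coparam c (q, p)).1, a *: (coparam c (q, p)).2).
Proof. by rewrite /coparam /= scalemxAl. Qed.

Lemma kinetic_coparamZ q a p :
  kinetic (coparam c (q, a *: p)) = a ^+ 2 * kinetic (coparam c (q, p)).
Proof. by rewrite coparamZ kineticZ. Qed.

Lemma kinetic_coparam0 q : kinetic (coparam c (q, 0)) = 0.
Proof. by rewrite -(scale0r 0) kinetic_coparamZ expr0n mul0r. Qed.

Lemma coparam_momentum_neq0 q p : img c q -> p != 0 -> (coparam c (q, p)).2 != 0.
Proof.
move=> iq; apply: contraNneq => /= e.
have := congr1 (fun w => w.2) (coparamK ac (z := (q, p)) iq).
by rewrite /= e mul0mx => <-.
Qed.

Lemma kinetic_coparam_gt0 q p : img c q -> p != 0 -> 0 < kinetic (coparam c (q, p)).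
Proof. by move=> iq p0; apply/kinetic_gt0/coparam_momentum_neq0. Qed.

(** A difference of two energies over the same point, through which kinetic energy inherits
    smoothness from the energy. *)
Lemma kinetic_difference q p : kinetic (coparam c (q, p)) =
  energy S (coparam c (q, p)) - energy S (coparam c (q, 0)).
Proof. by rewrite !energyE kinetic_coparam0 /= sub0r opprK subrK. Qed.

Lemma Ck_on_kinetic k p :
  Ck_on k (img c) (fun q => kinetic (coparam c (q, p))).
Proof.
have oi := @img_open _ _ c.
have C p' : Ck_on k (img c) (fun q : 'rV[R]_2 => (energy S \o coparam c) (q, p')).
  apply: (Ck_on_comp_pair (f := fun q : 'rV[R]_2 => (q, p')) oi _ _ (Ck_on_energy ac k)) => //.
  apply: Ck_on_pair => //; last exact: Ck_on_cst.
  by apply: (@Ck_on_lin _ _ _ _ _ idfun) => q; exact: cvg_id.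
have H := Ck_on_add oi (C p) (Ck_on_mul oi (Ck_on_cst k (img c) (-1 : R)) (C 0)).
by apply: Ck_on_eq H => // q _; rewrite kinetic_difference mulN1r.
Qed.

Lemma kinetic_eq0 z : img c z.1 -> kinetic (coparam c z) = 0 -> z.2 = 0.
Proof.
case: z => q p iq k0; apply/eqP; apply/negP => /negP p0.
by have := kinetic_coparam_gt0 iq p0; rewrite k0 ltxx.
Qed.

(* Over a zero of [force + e] the momentum vanishes, so regularity of e gives a
   direction in which [force + e] increases; small momenta lift it to the level. *)
Lemma interior_level_dense e z N :
  (exists w, 'd (energy S \o coparam c) z w != 0) ->
  img c z.1 -> energy S (coparam c z) = e -> nbhs z N ->
  exists y, [/\ N y, img c y.1, energy S (coparam c y) = e &
    0 < force (param c y.1) + e].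
Proof.
move=> [w dw] iz ez nN; pose U := @force R S \o param c.
have kz : kinetic (coparam c z) = U z.1 + e.
  by rewrite -ez energyE addrC subrK.
have : 0 <= U z.1 + e by rewrite -kz; exact: kinetic_ge0.
rewrite le_eqVlt => /orP[/eqP Ue|]; last first.
  by exists z; split => //; exact: nbhs_singleton.
have oi := @img_open _ _ c.
have dU : differentiable U z.1 by have [d _] := @force_smooth R S c ac 1%N; exact: d.
have dh := differentiable_energy ac iz.
have z20 : z.2 = 0 by apply: kinetic_eq0 => //; rewrite kz -Ue.
(* The sum of the energy and U is the kinetic energy, which attains its minimum 0 at z. Hence the
   differentials of the energy and of U are opposite at z, and regularity of e makes that of U
   nonzero. *)
have DU0 : 'D_w.1 U z.1 != 0.
  have [dUf DUf] := @derive_fst_comp R 'rV[R]_2 _ _ U z w dU.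
  have KE : (energy S \o coparam c) + (U \o fst) = @kinetic R S \o coparam c.
    by apply/funext => y; exact: (subrK (force (coparam c y).1) (kinetic (coparam c y))).
  have D0 : 'D_w ((energy S \o coparam c) + (U \o fst)) z = 0.
    apply: derive_local_min.
      have nD : nbhs z (img c `*` setT).
        by apply: open_nbhs_nbhs; split; [exact: open_setXT|split].
      apply: filterS nD => y [iy _]; apply: differentiableD.
        exact: differentiable_energy.
      have dUy : differentiable U y.1 by have [d _] := @force_smooth R S c ac 1%N; exact: d.
      by have [] := @derive_fst_comp R 'rV[R]_2 _ _ U y w dUy.
    by rewrite KE; apply: filterE => y; rewrite [X in X <= _]kz -Ue; exact: kinetic_ge0.
  rewrite (deriveD (diff_derivable dh) (diff_derivable dUf)) DUf in D0.
  apply: contraNneq dw => D1; rewrite D1 addr0 in D0.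
  by rewrite -(deriveE w dh) D0.
have [u Du] : exists u, 0 < 'D_u U z.1.
  case: (ltgtP ('D_w.1 U z.1) 0) => D; [|by exists w.1|by rewrite D eqxx in DU0].
  exists (- w.1); rewrite (deriveE _ dU) linearN -(deriveE _ dU).
  by rewrite oppr_gt0.
pose p : 'rV[R]_2 := delta_mx 0 0.
have p0 : p != 0.
  by apply/eqP => /rowP/(_ 0); rewrite !mxE /= => /eqP; rewrite oner_eq0.
pose K q := kinetic (coparam c (q, p)).
pose l (t : R) := t *: u + z.1.
(* The momentum is scaled so that its kinetic energy is U + e at [l t]. It tends to 0 with t, so the
   curve [y] is continuous at 0 with value z; where U + e is negative the square root returns 0, and
   such t are not selected. *)
pose b t := Num.sqrt ((U (l t) + e) / K (l t)) *: p.
pose y t : 'rV[R]_2 * 'rV[R]_2 := (l t, b t).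
have y0 : y 0 = z.
  rewrite [RHS]surjective_pairing z20 /y /b /l scale0r add0r -Ue mul0r sqrtr0.
  by rewrite scale0r.
have cy : {for 0, continuous y}.
  have cl : {for 0, continuous l} by exact: differentiable_continuous.
  have l0 : l 0 = z.1 by rewrite /l scale0r add0r.
  have K0 : K z.1 != 0 by rewrite gt_eqF// kinetic_coparam_gt0.
  have cK : {for l 0, continuous K} by rewrite l0; exact: (Ck_on_kinetic 0 p) iz.
  have cU : {for l 0, continuous U} by rewrite l0; exact: differentiable_continuous.
  suff cb : {for 0, continuous b} by exact: (cvg_pair (f := l) (g := b) cl cb).
  apply: (@continuous_comp _ _ _
    (fun t => Num.sqrt ((U (l t) + e) / K (l t))) ( *:%R^~ p)); last first.
    exact: scalel_continuous.
  apply: (@continuous_comp _ _ _ (fun t => (U (l t) + e) / K (l t)) Num.sqrt); last first.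
    exact: sqrt_continuous.
  apply: continuousM.
    by apply: continuousD; [exact: continuous_comp cl cU|exact: cst_continuous].
  by apply: continuousV; [rewrite l0|exact: continuous_comp cl cK].
have near0 : \forall t \near 0^'+, N (y t) /\ img c (y t).1.
  have nNi : nbhs z [set w | N w /\ img c w.1].
    apply: filterI nN _; apply: (@filterS _ _ _ (img c `*` setT)) => [w' []//|].
    by apply: open_nbhs_nbhs; split; [exact: open_setXT|split].
  rewrite -y0 in nNi.
  have H : \forall t \near (0 : R), N (y t) /\ img c (y t).1 by exact: cy _ nNi.
  by rewrite near_withinE; apply: filterS H => t Ht _.
have [t [[Nt it] Ut]] : exists t, (N (y t) /\ img c (y t).1) /\ U z.1 < U (l t).
  apply: (@filter_ex _ (0^'+ : set_system R)).
  exact: filterI near0 (derive_gt0_near dU Du).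
have Ut0 : 0 < U (l t) + e by rewrite Ue ltrD2r.
have Kt0 : 0 < K (l t) by exact: kinetic_coparam_gt0.
exists (y t); split; [exact: Nt|exact: it| |exact: Ut0].
have Et : kinetic (coparam c (y t)) = U (l t) + e.
  rewrite /y /b kinetic_coparamZ sqr_sqrtr; last by rewrite divr_ge0 ?ltW.
  by rewrite -/(K (l t)) divfK ?gt_eqF.
by rewrite energyE Et addrAC subrr add0r.
Qed.

End EnergyDensity.

(** * Comparison of the two energies *)

Section LevelRelation.
Context {R : realType}.
Variables (S S' : billiard R) (phi : S -> S') (kappa : S -> R) (e e' : R).
Hypotheses (sphi : smooth_map phi) (uphi : forall x, tangent_map phi x \in unitmx).
Hypothesis kappaE : forall x p,
  kinetic (cotangent_lift phi (x, p)) = kappa x * kinetic (x, p).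
Hypothesis lift_level : forall z, energy S z = e ->
  energy S' (cotangent_lift phi z) = e'.

Lemma potential_relation x : 0 <= force x + e ->
  kappa x * (force x + e) = force (phi x) + e'.
Proof.
move=> fe; have [p kp] := kinetic_surj x fe.
have := lift_level (z := (x, p)); rewrite !energyE kp addrAC subrr add0r => /(_ erefl).
by rewrite kappaE kp => <-; rewrite [RHS]addrC subrK.
Qed.

(** It is valid for every covector over a point with [force + e] nonnegative, on the level or off
    it, since the kinetic relation has no restriction on momenta. This is what allows
    differentiation over the open region. *)
Lemma energy_relation z : 0 <= force z.1 + e ->
  energy S' (cotangent_lift phi z) = e' + kappa z.1 * (energy S z - e).
Proof.
case: z => x p fe; have := potential_relation fe.
by rewrite !energyE kappaE /= => fE; rewrite -addrA -opprD mulrBr fE; ring.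
Qed.

Variables (c : chart R S) (c' : chart R S').
Hypotheses (ac : atlas S c) (ac' : atlas S' c').

Let D := local_dom phi c c'.
Let f := local_map phi c c'.
Let h := energy S \o coparam c.
Let h' := energy S' \o coparam c'.

Let oD : open D. Proof. exact: open_local_dom. Qed.
Let oDT : open (D `*` [set: 'rV[R]_2]). Proof. exact: open_setXT. Qed.
Let Cf k : Ck_on k D f. Proof. exact: Ck_on_local_map. Qed.
Let uf q : D q -> jacobian f q \in unitmx. Proof. exact: unit_jacobian_local_map. Qed.
Let DTi : D `*` [set: 'rV[R]_2] `<=` img c `*` setT. Proof. by move=> z [[iz _] _]. Qed.

Lemma local_energy_lift z : D z.1 ->
  h' (colift f z) = energy S' (cotangent_lift phi (coparam c z)).
Proof.
move=> Dz; rewrite /h' /= -(local_cotangent_lift sphi uphi ac ac' Dz) cocoordK//.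
by have [] := Dz.
Qed.

Lemma colift_img z : D z.1 -> img c' (colift f z).1.
Proof. by move=> [iz c'z]; exact: coord_img. Qed.

Lemma Ck_on_lifted_energy k : Ck_on k (D `*` setT) (h' \o colift f).
Proof.
apply: (Ck_on_comp_pair oDT _ (Ck_on_colift oD (Cf k.+1) uf) (Ck_on_energy ac' k)).
by move=> z [Dz _]; split => //; exact: colift_img.
Qed.

Lemma kappa_coparam z p : D z -> kappa (param c z) * kinetic (coparam c (z, p)) =
  h' (colift f (z, p)) - h' (colift f (z, 0)).
Proof.
move=> Dz; rewrite !local_energy_lift// !energyE /coparam !kappaE mul0mx kinetic0.
by rewrite mulr0 sub0r opprK subrK.
Qed.

(** Dividing [kappa_coparam] by the kinetic energy of a fixed nonzero [p] displays [kappa], which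
    was chosen pointwise, as a quotient of smooth functions. *)
Lemma Ck_on_kappa k : Ck_on k D (kappa \o param c).
Proof.
pose p : 'rV[R]_2 := delta_mx 0 0.
have p0 : p != 0.
  by apply/eqP => /rowP/(_ 0); rewrite !mxE /= => /eqP; rewrite oner_eq0.
have Cp p' : Ck_on k D (fun q : 'rV[R]_2 => (h' \o colift f) (q, p')).
  apply: (Ck_on_comp_pair (f := fun q : 'rV[R]_2 => (q, p')) oD _ _ (Ck_on_lifted_energy k)) => //.
  apply: Ck_on_pair => //; last exact: Ck_on_cst.
  by apply: (@Ck_on_lin _ _ _ _ _ idfun) => q; exact: cvg_id.
have kin0 q : D q -> kinetic (coparam c (q, p)) != 0.
  by move=> [iq _]; rewrite gt_eqF// kinetic_coparam_gt0.
have CK : Ck_on k D (fun q => kinetic (coparam c (q, p))).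
  by apply: Ck_on_sub (Ck_on_kinetic ac k p) => q [].
have H := Ck_on_mul oD (Ck_on_add oD (Cp p) (Ck_on_mul oD (Ck_on_cst k D (-1 : R)) (Cp 0)))
  (Ck_on_inv oD kin0 CK).
apply: Ck_on_eq H => // q Dq; rewrite mulN1r.
have E := kappa_coparam p Dq.
by apply: (canLR (mulfK (kin0 q Dq))); exact: esym E.
Qed.

(** In the derivative of the energy relation, the term containing the derivative of [kappa] is
    multiplied by [h z - e], which vanishes on the level. *)
Lemma derive_lifted_energy_interior z w : D z.1 -> h z = e ->
  0 < force (param c z.1) + e ->
  'D_w (h' \o colift f) z = kappa (param c z.1) * 'D_w h z.
Proof.
move=> Dz hz fz.
have dh : differentiable h z by apply: differentiable_energy => //; have [] := Dz.
have dk0 : differentiable (kappa \o param c) z.1.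
  by have [d _] := Ck_on_kappa 1; exact: d.
have [dk _] := @derive_fst_comp R 'rV[R]_2 _ _ (kappa \o param c) z w dk0.
pose U := @force R S \o param c.
have oP : open (D `&` U @^-1` `]-e, +oo[).
  apply: open_preimage_on => [//|q [iq _]|]; last exact: interval_open.
  by have [d _] := @force_smooth R S c ac 1%N; exact/differentiable_continuous/d.
have oPT := open_setXT oP.
have Pz : ((D `&` U @^-1` `]-e, +oo[) `*` [set: 'rV[R]_2]) z.
  by split => //; split => //; rewrite /= in_itv/= andbT -subr_gt0 opprK.
pose g := (kappa \o param c) \o (fst : 'rV[R]_2 * 'rV[R]_2 -> 'rV[R]_2).
have N : \near z, (cst e' + g * (h - cst e)) z = (h' \o colift f) z.
  apply: open_nbhs_eq oPT _ Pz => y [[Dy]]; rewrite /= in_itv/= andbT => Uy _.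
  rewrite [RHS](local_energy_lift Dy) energy_relation//.
  by rewrite ltW// -(opprK e) subr_gt0.
have dhe : differentiable (h - cst e) z by apply: differentiableB.
have dgh := differentiableM dk dhe.
have E := near_eq_derive w N; rewrite -[LHS]E.
rewrite (deriveD (derivable_cst _ _ _) (diff_derivable dgh)) derive_cst add0r.
rewrite (deriveM (diff_derivable dk) (diff_derivable dhe)).
rewrite [X in _ + X](_ : _ = 0); last first.
  by rewrite [(h - cst e) z](_ : _ = h z - e)// hz subrr scale0r.
by rewrite addr0 (deriveB (diff_derivable dh) (derivable_cst _ _ _)) derive_cst subr0.
Qed.

(* When [force + e = 0] the two sides of the energy relation need not agree
   near z; the identity extends there by continuity and density. *)
Lemma derive_lifted_energy z w : D z.1 -> h z = e ->
  (exists w, 'd h z w != 0) ->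
  'D_w (h' \o colift f) z = kappa (param c z.1) * 'D_w h z.
Proof.
move=> Dz hz reg.
pose psi y := 'D_w (h' \o colift f) y + (-1) * ((kappa \o param c) y.1 * 'D_w h y).
have Cpsi : Ck_on 0 (D `*` setT) psi.
  have [_ C1] := Ck_on_lifted_energy 1.
  have [_ C2] := Ck_on_sub DTi (Ck_on_energy ac 1).
  apply: Ck_on_add => //; first exact: C1.
  apply: Ck_on_mul => //; first exact: Ck_on_cst.
  apply: Ck_on_mul => //; last exact: C2.
  by apply: (@Ck_on_fst _ _ R^o) => //; exact: Ck_on_kappa.
suff : psi z = 0 by rewrite /psi mulN1r => /eqP; rewrite subr_eq0 => /eqP.
apply/eqP; apply/negP => /negP psi0.
have nD : nbhs z (D `*` [set: 'rV[R]_2]) by exact: open_nbhs_nbhs.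
have nP : nbhs z (psi @^-1` [set t | t != 0]).
  by apply: (Cpsi z) => //; apply: open_nbhs_nbhs; split => //; exact: open_neq.
have iz : img c z.1 by have [] := Dz.
have [y [[[Dy _] py] iy hy fy]] := interior_level_dense ac reg iz hz (filterI nD nP).
move/negP: py; apply; rewrite /psi mulN1r subr_eq0; apply/eqP.
exact: derive_lifted_energy_interior.
Qed.

End LevelRelation.

(** * Pullback of first integrals *)

Section Pullback.
Context {R : realType}.
Variables (S S' : billiard R) (phi : S -> S').
Hypotheses (sphi : smooth_map phi) (uphi : forall x, tangent_map phi x \in unitmx).

Let oDT c c' : open (local_dom phi c c' `*` [set: 'rV[R]_2]).
Proof. exact/open_setXT/open_local_dom. Qed.

Lemma pullback_local (G : cotangent S' -> R) c c' z : atlas S c -> atlas S' c' ->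
  local_dom phi c c' z.1 ->
  ((G \o cotangent_lift phi) \o coparam c) z =
  ((G \o coparam c') \o colift (local_map phi c c')) z.
Proof.
move=> ac ac' Dz; rewrite [RHS]/= -(local_cotangent_lift sphi uphi ac ac' Dz).
by rewrite cocoordK//; have [] := Dz.
Qed.

Lemma Ck_on_pullback (G : cotangent S' -> R) k c c' : atlas S c -> atlas S' c' ->
  smooth_cotangent_function G ->
  Ck_on k (local_dom phi c c' `*` [set: 'rV[R]_2])
    ((G \o cotangent_lift phi) \o coparam c).
Proof.
move=> ac ac' sG; have oD := open_local_dom sphi (c := c) (c' := c').
have CF := Ck_on_colift oD (Ck_on_local_map sphi k.+1 ac ac')
  (fun q Dq => unit_jacobian_local_map sphi uphi ac ac' Dq).
have H : Ck_on k (local_dom phi c c' `*` [set: 'rV[R]_2])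
    ((G \o coparam c') \o colift (local_map phi c c')).
  apply: (Ck_on_comp_pair (@oDT c c') _ CF (sG c' ac' k)) => z [Dz _].
  by split; first exact: colift_img.
apply: Ck_on_eq (@oDT c c') _ H => z [Dz _]; apply: esym.
exact: pullback_local.
Qed.

Lemma smooth_pullback (G : cotangent S' -> R) : smooth_cotangent_function G ->
  smooth_cotangent_function (G \o cotangent_lift phi).
Proof.
move=> sG c ac k; apply: Ck_on_local => z [iz _].
have ac' := chart_at_atlas (phi (param c z.1)).
exists (local_dom phi c (chart_at (phi (param c z.1))) `*` setT).
  by split => //; split => //; exact: chart_at_dom.
exact: Ck_on_pullback.
Qed.

Hypothesis hreg : regular_energies S.
Hypothesis cphi : conformal phi.
Hypothesis hlev : sends_levels S S' (cotangent_lift phi).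

Lemma regular_at e c z : energies S e -> atlas S c -> img c z.1 ->
  energy S (coparam c z) = e -> exists w, 'd (energy S \o coparam c) z w != 0.
Proof. by move=> he ac iz ez; exact: hreg he c ac z iz ez. Qed.

Lemma lift_level_eq e : energies S e -> exists2 e', energies S' e' &
  forall z, energy S z = e -> energy S' (cotangent_lift phi z) = e'.
Proof.
move=> /hlev[e' he' H]; exists e' => // z ez.
by apply: H; exists z.
Qed.

(** The given level point is first replaced by a nearby one [y] with [force + e] positive. Around
    [y] the energy relation holds and [kappa] is positive, so a point is on the level e as soon as
    its image is on the level e'. Local surjectivity of the lift then provides such a point [w] over
    a point where the integral of the second system is independent of its energy. *)
Lemma independent_pullback (G : cotangent S' -> R) :
  smooth_cotangent_function G -> independent_of_energy G ->
  independent_of_energy (G \o cotangent_lift phi).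
Proof.
move=> sG iG e he c ac level z [iz ez] N nN.
have [e' he' hl] := lift_level_eq he.
have [kappa kP] := conformal_kinetic uphi cphi.
have k0 x : 0 < kappa x by have [] := kP x.
have kE x p : kinetic (cotangent_lift phi (x, p)) = kappa x * kinetic (x, p).
  by have [_] := kP x.
have [y [Ny iy ey fy]] := interior_level_dense ac (regular_at he ac iz ez) iz ez (nbhs_interior nN).
have [x0 Ex0] : exists x, x = phi (param c y.1) by exists (phi (param c y.1)).
pose c' := chart_at x0; have ac' : atlas S' c' by exact: chart_at_atlas.
pose D := local_dom phi c c'; pose f := local_map phi c c'.
pose U := @force R S \o param c.
have oD : open D by exact: open_local_dom.
have Dy : D y.1 by split => //; rewrite /= -Ex0; exact: chart_at_dom.
have Cf k : Ck_on k D f by exact: Ck_on_local_map.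
have uf q : D q -> jacobian f q \in unitmx by exact: unit_jacobian_local_map.
have oP : open (D `&` U @^-1` `]-e, +oo[).
  apply: open_preimage_on => [//|q [iq _]|]; last exact: interval_open.
  by have [d _] := @force_smooth R S c ac 1%N; exact/differentiable_continuous/d.
have oPT := open_setXT oP.
have inP w : ((D `&` U @^-1` `]-e, +oo[) `*` [set: 'rV[R]_2]) w ->
    D w.1 /\ 0 < U w.1 + e.
  move=> [[Dw]]; rewrite /= in_itv/= andbT => Uw _; split => //.
  by rewrite -(opprK e) subr_gt0.
have Py : ((D `&` U @^-1` `]-e, +oo[) `*` [set: 'rV[R]_2]) y.
  by split => //; split => //; rewrite /= in_itv/= andbT -subr_gt0 opprK.
have nP := open_nbhs_nbhs (conj oPT Py).
have levelF w : D w.1 -> 0 <= U w.1 + e ->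
    energy S' (coparam c' (colift f w)) = e' + kappa (param c w.1) * (energy S (coparam c w) - e).
  move=> Dw fw.
  apply: etrans (local_energy_lift sphi uphi ac ac' Dw) _.
  exact: (energy_relation kE hl).
have lF : [set w | img c' w.1 /\ energy_level S' e' (coparam c' w)] (colift f y).
  split; first exact: colift_img Dy.
  by rewrite /energy_level /= levelF ?ltW// ey subrr mulr0 addr0.
have nNP : nbhs y (N `&` ((D `&` U @^-1` `]-e, +oo[) `*` setT)) by exact: filterI Ny nP.
have nI := local_surjection_colift oD (Cf 1) uf Dy nNP.
have [z1 [[[iw' ew'] indep] [w [Nw Pw] Ew]]] := iG e' he' c' ac' _ lF _ nI.
rewrite -{}Ew in iw' ew' indep.
have [Dw Uw] := inP _ Pw.
have iw : img c w.1 by have [] := Dw.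
have ew : energy S (coparam c w) = e.
  have E := levelF w Dw (ltW Uw); rewrite [LHS]ew' in E.
  have /eqP : kappa (param c w.1) * (energy S (coparam c w) - e) = 0.
    by apply: (addrI e'); rewrite addr0.
  by rewrite mulf_eq0 (gt_eqF (k0 _)) subr_eq0 => /eqP.
exists w; split; last exact: Nw.
split; first by split; [exact: iw|exact: ew].
have dF := differentiable_colift oD (Cf 2) uf Dw.
have dh : differentiable (energy S \o coparam c) w by exact: differentiable_energy.
have dh' : differentiable (energy S' \o coparam c') (colift f w).
  by apply: differentiable_energy => //; exact: colift_img.
have dg' : differentiable (G \o coparam c') (colift f w).
  by have [d _] := sG c' ac' 1%N; apply: d; split => //; exact: colift_img.
have Dh v : 'D_v (energy S \o coparam c) w = (kappa (param c w.1))^-1 *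
    'D_('D_v (colift f) w) (energy S' \o coparam c') (colift f w).
  have E := derive_lifted_energy_interior sphi uphi kE hl ac ac' v Dw ew Uw.
  have E' := derive_comp v dF dh'.
  have kw := lt0r_neq0 (k0 (param c w.1)).
  have E2 := etrans (esym E) E'.
  exact: canRL (mulKf kw) E2.
have nE : \near w, ((G \o coparam c') \o colift f) w =
    ((G \o cotangent_lift phi) \o coparam c) w.
  apply: (@open_nbhs_eq _ _ (D `*` setT)) => [|v [Dv _]|//]; first exact: oDT.
  by apply: esym; exact: pullback_local.
have dg : differentiable ((G \o cotangent_lift phi) \o coparam c) w.
  exact: near_eq_differentiable nE (differentiable_comp dF dg').
have Dg v : 'D_v ((G \o cotangent_lift phi) \o coparam c) w =
    'D_('D_v (colift f) w) (G \o coparam c') (colift f w).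
  have E1 := near_eq_derive v nE.
  have E2 := derive_comp v dF dg'.
  transitivity ('D_v ((G \o coparam c') \o colift f) w); first exact: (esym E1).
  exact: E2.
move=> a b ab.
have combine (x1 x2 y1 y2 k : R) : x1 = k^-1 * y1 -> x2 = y2 ->
    a * x1 + b * x2 = 0 -> a * k^-1 * y1 + b * y2 = 0.
  by move=> -> ->; rewrite mulrA.
(* Every direction at the image is a pushed-forward one, so a relation with coefficients a, b
   between the differentials at [w] becomes one with coefficients a / kappa, b at the image. *)
have [|a0 b0] := indep (a * (kappa (param c w.1))^-1) b.
  move=> w'; have [v <-] := derive_colift_surjective oD (Cf 2) uf Dw w'.
  have e1 := deriveE v dh; have e2 := deriveE ('D_v (colift f) w) dh'.
  have e3 := deriveE v dg; have e4 := deriveE ('D_v (colift f) w) dg'.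
  apply: combine (ab v); last exact: etrans (esym e3) (etrans (Dg v) e4).
  exact: etrans (esym e1) (etrans (Dh v) (congr1 ( *%R _) e2)).
split; last exact: b0.
by move/eqP: a0; rewrite mulf_eq0 invr_eq0 (gt_eqF (k0 _)) orbF => /eqP.
Qed.

End Pullback.

(** * Motions and their lifts *)

Section Motions.
Context {R : realType}.

Lemma is_derive_comp1 (W : normedModType R) (zeta : R -> W) (tau : R -> R) (u k : R) (dz : W) :
  is_derive u 1 tau k -> is_derive (tau u) 1 zeta dz ->
  is_derive u 1 (zeta \o tau) (k *: dz).
Proof.
move=> [dt Et] [dz' Ez].
have dt' : differentiable tau u by exact/derivable1_diffP.
have dzz : differentiable zeta (tau u) by exact/derivable1_diffP.
have dc := differentiable_comp dt' dzz.
apply: DeriveDef; first exact: diff_derivable.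
rewrite (derive_comp _ dt' dzz) Et -Ez (deriveE _ dzz) (deriveE _ dzz).
by rewrite -linearZ; congr ('d zeta (tau u) _); rewrite [RHS]mulr1.
Qed.

Lemma is_derive_post (V W : normedModType R) (F : V -> W) (zeta : R -> V) (u : R) (dz : V) :
  is_derive u 1 zeta dz -> differentiable F (zeta u) ->
  is_derive u 1 (F \o zeta) ('D_dz F (zeta u)).
Proof.
move=> [dz' Ez] dF.
have dzz : differentiable zeta u by exact/derivable1_diffP.
have dc := differentiable_comp dzz dF.
apply: DeriveDef; first exact: diff_derivable.
by rewrite (derive_comp _ dzz dF) Ez.
Qed.

Variables (S S' : billiard R) (phi : S -> S').
Hypotheses (sphi : smooth_map phi) (uphi : forall x, tangent_map phi x \in unitmx).
Hypothesis hreg : regular_energies S.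
Hypothesis cphi : conformal phi.
Hypothesis hlev : sends_levels S S' (cotangent_lift phi).

Lemma kappa_continuous (kappa : S -> R) :
  (forall x p, kinetic (cotangent_lift phi (x, p)) = kappa x * kinetic (x, p)) ->
  continuous kappa.
Proof.
move=> kE x; pose c := chart_at x.
have ac : atlas S c by exact: chart_at_atlas.
have cx : dom c x by exact: chart_at_dom.
have ac' := chart_at_atlas (phi x).
have Dx : local_dom phi c (chart_at (phi x)) (coord c x).
  by apply: local_dom_coord => //; exact: chart_at_dom.
have ck : {for coord c x, continuous (kappa \o param c)}.
  by have C := Ck_on_kappa sphi uphi kE ac ac' 0; exact: C.
have cc : {for x, continuous (coord c)} by exact: coord_continuous.
have H : (kappa \o param c) \o coord c @ x --> kappa x.
  have := continuous_comp cc ck; rewrite /continuous_at.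
  by rewrite [X in _ --> X -> _](_ : _ = kappa x)//= coordK.
apply: cvg_trans H; apply: near_eq_cvg.
by apply: filterS (open_nbhs_nbhs (conj (@dom_open _ _ c) cx)) => y cy /=; rewrite coordK.
Qed.

Lemma hamiltonian_field_lifted (kappa : S -> R) e e' c c' z :
  (forall x p, kinetic (cotangent_lift phi (x, p)) = kappa x * kinetic (x, p)) ->
  (forall z, energy S z = e -> energy S' (cotangent_lift phi z) = e') ->
  energies S e -> atlas S c -> atlas S' c' -> local_dom phi c c' z.1 ->
  energy S (coparam c z) = e ->
  hamiltonian_field ((energy S' \o coparam c') \o colift (local_map phi c c')) z =
  kappa (param c z.1) *: hamiltonian_field (energy S \o coparam c) z.
Proof.
move=> kE hl he ac ac' Dz ez.
have iz : img c z.1 by have [] := Dz.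
have reg := regular_at hreg he ac iz ez.
have dh : differentiable (energy S \o coparam c) z by exact: differentiable_energy.
have dF : differentiable ((energy S' \o coparam c') \o colift (local_map phi c c')) z.
  by have [d _] := Ck_on_lifted_energy sphi uphi ac ac' 1; apply: d.
have E w := derive_lifted_energy sphi uphi kE hl ac ac' w Dz ez reg.
have h1 := hamiltonian_fieldE dF; have h2 := hamiltonian_fieldE dh.
refine (etrans h1 (etrans _ (congr1 (fun w => kappa (param c z.1) *: w) (esym h2)))).
have row_scale (k : R) (x y : 'I_2 -> R) : (forall i, x i = k * y i) ->
    \row_i x i = k *: \row_i y i.
  by move=> xy; apply/rowP => i; rewrite !mxE.
have E1 := row_scale _ _ _ (fun i => E (0, delta_mx 0 i)).
have E2 := row_scale _ _ _ (fun i => E (delta_mx 0 i, 0)).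
refine (etrans (congr2 (fun x y => (x, - y)) E1 E2) _).
by rewrite -scalerN.
Qed.

Lemma lift_motion (kappa : S -> R) e e' gamma a b (tau : R -> R) c0 d0 :
  (forall x p, kinetic (cotangent_lift phi (x, p)) = kappa x * kinetic (x, p)) ->
  (forall z, energy S z = e -> energy S' (cotangent_lift phi z) = e') ->
  energies S e -> motion gamma a b ->
  (forall t, a < t < b -> energy_level S e (gamma t)) ->
  (forall u, c0 < u < d0 -> a < tau u < b /\
     is_derive u 1 tau (kappa (gamma (tau u)).1)) ->
  motion (cotangent_lift phi \o gamma \o tau) c0 d0.
Proof.
move=> kE hl he mg lg Ht u ud.
have [tab dt] := Ht u ud; have [cg mgt] := mg _ tab.
have ct : {for u, continuous tau}.
  by apply/differentiable_continuous/derivable1_diffP; case: dt.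
have cq : {for u, continuous (fun v => (gamma (tau v)).1)}.
  exact: (continuous_comp ct cg).
have cphi' : {for u, continuous (fun v => phi (gamma (tau v)).1)}.
  by apply: (continuous_comp cq); exact: sphi.1.
split; first exact: cphi'.
move=> c' ac' c'u.
pose t := tau u; pose c := chart_at (gamma t).1.
have ac : atlas S c by exact: chart_at_atlas.
have ct' : dom c (gamma t).1 by exact: chart_at_dom.
have dz := mgt c ac ct'.
pose zeta := cocoord c \o gamma; pose f := local_map phi c c'.
have Dz : local_dom phi c c' (zeta t).1 by apply: local_dom_coord.
have oD : open (local_dom phi c c') by exact: open_local_dom.
have Cf : Ck_on 2 (local_dom phi c c') f by exact: Ck_on_local_map.
have uf q : local_dom phi c c' q -> jacobian f q \in unitmx.
  exact: unit_jacobian_local_map.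
have ez : energy S (coparam c (zeta t)) = e.
  by rewrite /zeta /= cocoordK//; exact: lg.
have dF := differentiable_colift oD Cf uf Dz.
have D1 := is_derive_comp1 dt dz.
have D2 := is_derive_post D1 dF.
have nE : \near u, (colift f \o (zeta \o tau)) u =
    (cocoord c' \o (cotangent_lift phi \o gamma \o tau)) u.
  have n1 : \forall v \near u, dom c (gamma (tau v)).1.
    by apply: cq; apply: open_nbhs_nbhs; split => //; exact: dom_open.
  have n2 : \forall v \near u, dom c' (phi (gamma (tau v)).1).
    by apply: cphi'; apply: open_nbhs_nbhs; split => //; exact: dom_open.
  apply: filterS (filterI n1 n2) => v [cv c'v].
  have Dv : local_dom phi c c' (zeta (tau v)).1 by apply: local_dom_coord.
  rewrite [LHS]/= -(local_cotangent_lift sphi uphi ac ac' Dv).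
  by rewrite /zeta /= cocoordK.
apply: is_derive_eq (near_eq_is_derive nE D2) _.
have HL := hamiltonian_field_lifted kE hl he ac ac' Dz ez.
have kt : param c (zeta t).1 = (gamma t).1 by rewrite /zeta /= coordK.
rewrite kt in HL.
have dh' : differentiable (energy S' \o coparam c') (colift f (zeta t)).
  exact: (differentiable_energy ac' (colift_img Dz)).
have Fz : colift f (zeta t) = cocoord c' ((cotangent_lift phi \o gamma \o tau) u).
  rewrite -(local_cotangent_lift sphi uphi ac ac' Dz).
  by rewrite /zeta /= cocoordK.
have DH := derive_colift_hamiltonian oD Cf uf Dz dh'.
(* The chain rule for [tau] multiplies the Hamiltonian field of the first energy by [kappa]. By [HL]
   the result is the Hamiltonian field of the lifted energy, which the symplectic lift transports to
   that of the second energy. *)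
transitivity ('D_(hamiltonian_field ((energy S' \o coparam c') \o colift f) (zeta t))
    (colift f) (zeta t)); last by rewrite -Fz; exact: DH.
by rewrite [X in _ = 'D_X _ _]HL.
Qed.

(** Conservation compares two times only, so it suffices to reparametrise the motion on a part of
    its interval that contains both. *)
Lemma preserved_by_motions_pullback (G : cotangent S' -> R) :
  preserved_by_motions G -> preserved_by_motions (G \o cotangent_lift phi).
Proof.
move=> mG gamma a b e mg he lg s t sab tab.
have [e' he' hl] := lift_level_eq hlev he.
have [kappa kP] := conformal_kinetic uphi cphi.
have kE x p : kinetic (cotangent_lift phi (x, p)) = kappa x * kinetic (x, p).
  by have [_] := kP x.
have [|tau [c0 [d0 [Ht [u1 [u2 [u1d u2d <- <-]]]]]]] :=
    @time_change R (fun t => kappa (gamma t).1) a b s t _ sab tab.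
  move=> u /mg [cg _]; split; first by have [] := kP (gamma u).1.
  apply: (@continuous_comp _ _ _ (fun t => (gamma t).1) kappa); first exact: cg.
  exact: kappa_continuous.
have mg' := lift_motion kE hl he mg lg Ht.
apply: (mG _ c0 d0 e' mg' he' _ u1 u2 u1d u2d) => u ud.
by apply: hl; apply: lg; have [] := Ht u ud.
Qed.

End Motions.

(** * Image arcs and reflections *)

Section Reflections.
Context {R : realType}.
Variables (S S' : billiard R) (phi : S -> S').
Hypotheses (sphi : smooth_map phi) (uphi : forall x, tangent_map phi x \in unitmx).

Lemma derive_image_arc (beta : R -> S) c c' s : atlas S c -> atlas S' c' ->
  {for s, continuous beta} -> dom c (beta s) -> dom c' (phi (beta s)) ->
  derivable (coord c \o beta) s 1 ->
  derivable (coord c' \o (phi \o beta)) s 1 /\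
  derive1 (coord c' \o (phi \o beta)) s =
    derive1 (coord c \o beta) s *m jacobian (local_map phi c c') (coord c (beta s)).
Proof.
move=> ac ac' cb cs c's db.
have dz : differentiable (coord c \o beta) s by exact/derivable1_diffP.
have df := differentiable_local_map sphi ac ac' cs c's.
have dc := differentiable_comp dz df.
have nE : \near s, (local_map phi c c' \o (coord c \o beta)) s = (coord c' \o (phi \o beta)) s.
  have n1 : \forall v \near s, dom c (beta v).
    by apply: cb; apply: open_nbhs_nbhs; split => //; exact: dom_open.
  by apply: filterS n1 => v cv; rewrite /local_map /= coordK.
have d2 := near_eq_differentiable nE dc.
split; first exact/derivable1_diffP.
rewrite !derive1E.
transitivity ('D_1 (local_map phi c c' \o (coord c \o beta)) s).
  have E1 := near_eq_derive (1 : R) nE.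
  exact: (esym E1).
have E2 := derive_comp (1 : R) dz df; apply: (etrans E2).
exact: deriveEjacobian.
Qed.

Lemma C1_arc_image (beta : R -> S) a b : C1_arc beta a b -> C1_arc (phi \o beta) a b.
Proof.
move=> Cb t tab; have [cb db] := Cb t tab.
have cpb : {for t, continuous (phi \o beta)}.
  by apply: (continuous_comp cb); exact: sphi.1.
split; first exact: cpb.
move=> c' ac' c't; pose c := chart_at (beta t).
have ac : atlas S c by exact: chart_at_atlas.
have ct : dom c (beta t) by exact: chart_at_dom.
have [dt cdt] := db c ac ct.
split; first exact: (derive_image_arc ac ac' cb ct c't dt).1.
pose f := local_map phi c c'; pose zeta := coord c \o beta.
(* The chain-rule expression of the derivative of the image arc; it is continuous at t, and agrees
   with that derivative near t because the arc is C^1 on a whole interval. *)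
pose g s := derive1 zeta s *m jacobian f (zeta s).
have oD : open (local_dom phi c c') by exact: open_local_dom.
have Cf : Ck_on 1 (local_dom phi c c') f by exact: Ck_on_local_map.
have dzt := (derivable1_diffP _ _).1 dt.
have cz : {for t, continuous zeta} := differentiable_continuous dzt.
have cg : {for t, continuous g}.
  apply: (@continuous_comp _ _ _ (fun s => (zeta s, derive1 zeta s))
    (fun y : 'rV[R]_2 * 'rV[R]_2 => y.2 *m jacobian f y.1)).
    exact: cvg_pair cz cdt.
  by apply: (Ck_on_pushforward oD Cf); split => //; apply: local_dom_coord.
have nab : \forall s \near t, s \in `]a, b[ by apply: near_in_itvoo; rewrite in_itv.
have n1 : \forall v \near t, dom c (beta v).
  by apply: cb; apply: open_nbhs_nbhs; split => //; exact: dom_open.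
have n2 : \forall v \near t, dom c' (phi (beta v)).
  by apply: cpb; apply: open_nbhs_nbhs; split => //; exact: dom_open.
have nE : \forall s \near t, g s = derive1 (coord c' \o (phi \o beta)) s.
  apply: filterS (filterI nab (filterI n1 n2)) => s [].
  rewrite in_itv/= => sab [cs c's]; have [cbs dbs] := Cb s sab.
  have [ds _] := dbs c ac cs.
  exact: esym (derive_image_arc ac ac' cbs cs c's ds).2.
have E := nbhs_singleton nE.
rewrite /prop_for /continuous_at -E; apply: cvg_trans cg.
exact: near_eq_cvg.
Qed.

Lemma velocity_image (beta : R -> S) a b t : C1_arc beta a b -> a < t < b ->
  velocity (phi \o beta) t = velocity beta t *m tangent_map phi (beta t).
Proof.
move=> Cb tab; have [cb db] := Cb t tab.
have [dt _] := db _ (chart_at_atlas (beta t)) (chart_at_dom (beta t)).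
exact: (derive_image_arc (chart_at_atlas (beta t)) (chart_at_atlas (phi (beta t)))
  cb (chart_at_dom (beta t)) (chart_at_dom (phi (beta t))) dt).2.
Qed.

Lemma tangent_to_image (B : set S) (B' : set S') x tau : phi @` B `<=` B' ->
  tangent_to B x tau -> tangent_to B' (phi x) (tau *m tangent_map phi x).
Proof.
move=> BB [beta [eps [e0 Cb b0 Bb vb]]]; exists (phi \o beta), eps; split => //.
- exact: C1_arc_image.
- by rewrite /= b0.
- by move=> t /Bb Bt; apply: BB; exists (beta t).
- have e00 : - eps < 0 < eps by rewrite oppr_lt0 e0.
  by apply: etrans (velocity_image Cb e00) _; rewrite vb b0.
Qed.

Hypothesis cphi : conformal phi.
Hypothesis hwall : phi @` wall S `<=` wall S'.
Hypothesis hlev : sends_levels S S' (cotangent_lift phi).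

Lemma metricZl (M : riemannian_surface R) (x : M) a u v :
  metric x (a *: u) v = a * metric x u v.
Proof. by rewrite /metric /form2 -!scalemxAl mxE. Qed.

(** Read on velocities through the two metrics, the lift is the differential [T] divided by the
    conformal factor [l]. Such a map preserves orthogonality and carries the tangent line of the
    wall to that of its image, so it commutes with the splitting into tangential and normal
    parts. *)
Lemma preserved_by_reflections_pullback (G : cotangent S' -> R) :
  preserved_by_reflections G ->
  preserved_by_reflections (G \o cotangent_lift phi).
Proof.
move=> rG x tau v wx tx tau0 he.
have [e' he' hl] := lift_level_eq hlev he.
have [l l0 E] := conformal_gram x cphi.
set T := tangent_map phi x in E.
have uT : T \in unitmx by exact: uphi.
have uTt : T^T \in unitmx by rewrite unitmx_tr.
have lneq : l != 0 by rewrite gt_eqF.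
have mE u w : metric (phi x) (u *m T) (w *m T) = l * metric x u w.
  by rewrite /metric form2_mulmx E /form2 -scalemxAr -scalemxAl mxE.
have momE u : cotangent_lift phi (momentum x u) = momentum (phi x) (l^-1 *: (u *m T)).
  congr (_, _); apply: (can_inj (mulmxK uTt)); rewrite (mulmxKV uTt).
  rewrite -scalemxAl -scalemxAl -!mulmxA [T *m _]mulmxA E -scalemxAr scalerA.
  by rewrite mulVf// scale1r.
have tanE : tangential (phi x) (tau *m T) (l^-1 *: (v *m T)) =
    l^-1 *: (tangential x tau v *m T).
  rewrite /tangential metricZl !mE -scalemxAl scalerA; congr (_ *: _).
  by rewrite (mulKf lneq) invfM mulrCA.
have reflE : l^-1 *: (reflect_velocity x tau v *m T) =
    reflect_velocity (phi x) (tau *m T) (l^-1 *: (v *m T)).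
  by rewrite /reflect_velocity tanE -scalerBr -scalerBr !mulmxBl.
rewrite /= !momE reflE; apply: rG.
- by apply: hwall; exists x.
- exact: tangent_to_image hwall tx.
- by apply: contraNneq tau0 => e; rewrite -(mulmxK uT tau) e mul0mx.
- by rewrite -momE hl.
Qed.

End Reflections.

(** * Transfer of integrability and inverse branches *)

Section Transfer.
Context {R : realType}.

Lemma integrable_pullback (S S' : billiard R) (phi : S -> S') :
  regular_energies S -> regular_map phi -> conformal phi ->
  phi @` wall S `<=` wall S' -> sends_levels S S' (cotangent_lift phi) ->
  integrable_billiard S' -> integrable_billiard S.
Proof.
move=> hreg [sphi uphi] cphi hwall hlev [G [sG iG mG rG]].
exists (G \o cotangent_lift phi); split.
- exact: smooth_pullback.
- exact: independent_pullback.
- exact: preserved_by_motions_pullback.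
- exact: preserved_by_reflections_pullback.
Qed.

Variables (S S' : billiard R) (phi : S -> S') (psi : S' -> S).
Hypotheses (sphi : smooth_map phi) (spsi : smooth_map psi).
Hypothesis phiK : forall y, phi (psi y) = y.

(** The chain rule for [phi \o psi], which is the identity. Since [phi (psi y)] is y, both ends use
    the same chosen chart, so the Jacobian of the identity is the identity matrix. *)
Lemma tangent_map_section y :
  tangent_map psi y *m tangent_map phi (psi y) = 1%:M.
Proof.
pose a := chart_at y; pose b := chart_at (psi y).
have Aa : atlas S' a by exact: chart_at_atlas.
have Ab : atlas S b by exact: chart_at_atlas.
have ay : dom a y by exact: chart_at_dom.
have by_ : dom b (psi y) by exact: chart_at_dom.
have ea : chart_at (phi (psi y)) = a by rewrite phiK.
have d1 := differentiable_local_map spsi Aa Ab ay by_.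
have apy : dom a (phi (psi y)) by rewrite phiK.
have d2 := differentiable_local_map sphi Ab Aa by_ apy.
have e1 : local_map psi a b (coord a y) = coord b (psi y) by rewrite /local_map /= coordK.
have d2' := d2; rewrite -e1 in d2'.
have E := jacobian_comp d1 d2'; rewrite e1 in E.
rewrite /tangent_map ea; apply: etrans (esym E) _.
rewrite -(jacobian_id (coord a y)); apply: esym.
have oD := open_local_dom spsi (c := a) (c' := b).
have Dy : local_dom psi a b (coord a y) by exact: local_dom_coord.
apply: near_eq_jacobian (differentiable_comp d1 d2').
apply: filterS (open_nbhs_nbhs (conj oD Dy)) => q [iq bq].
by rewrite /local_map /= coordK// phiK paramK.
Qed.

(** The matrices are square, so a one-sided inverse makes the tangent map of [psi] invertible. *)
Lemma regular_section : regular_map psi.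
Proof.
split=> // y; exact: (mulmx1_unit (tangent_map_section y)).1.
Qed.

Lemma conformal_section : conformal phi -> conformal psi.
Proof.
move=> cphi y; have [l l0 E] := cphi (psi y).
exists l^-1; first by rewrite invr_gt0.
move=> u v; have := E (u *m tangent_map psi y) (v *m tangent_map psi y).
rewrite -!mulmxA tangent_map_section !mulmx1 phiK => ->.
by rewrite mulKf// gt_eqF.
Qed.

End Transfer.

Theorem theorem1 (R : realType) (S S' : billiard R) (phi : S -> S') (k : nat)
    (hregS : regular_energies S) (hregS' : regular_energies S')
    (hk : (0 < k)%N) (hphi_reg : regular_map phi) (hphi_conf : conformal phi)
    (hphi_k : k_to_1 k phi)
    (hwall : phi @` wall S `<=` wall S')
    (hlevels : sends_levels S S' (cotangent_lift phi)) :
  (integrable_billiard S' -> integrable_billiard S) /\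
  (integrable_billiard S ->
   forall psi : S' -> S,
     smooth_map psi -> (forall y, phi (psi y) = y) ->
     psi @` wall S' `<=` wall S ->
     sends_levels S' S (cotangent_lift psi) ->
     integrable_billiard S').
Proof.
split; first exact: (integrable_pullback hregS hphi_reg hphi_conf hwall hlevels).
have [sphi _] := hphi_reg => iS psi spsi phiK hwall' hlevels'.
have rpsi := regular_section sphi spsi phiK.
have cpsi := conformal_section sphi spsi phiK hphi_conf.
exact: (integrable_pullback hregS' rpsi cpsi hwall' hlevels' iS).
Qed.
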